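(* Let $p\in(-1,0)$ and let $\mu$ be a non-zero, even, discrete (i.e. finitely supported), finite Borel measure on $S^{n-1}$. Then there exists an origin-symmetric polytope $K\in\mathcal{K}_e^n$ such that $\mu=J_p(K,\cdot)$ if and only if $\mu$ is not concentrated entirely on any great subsphere of $S^{n-1}$.
   Context: $S^{n-1}$ is the unit sphere of $\mathbb{R}^n$. A convex body is a compact convex subset of $\mathbb{R}^n$ with nonempty interior; $\mathcal{K}_o^n$ is the class of convex bodies containing the origin in their interiors, and $\mathcal{K}_e^n\subset\mathcal{K}_o^n$ is the class of origin-symmetric convex bodies ($K=-K$). A polytope is the convex hull of finitely many points. For $K\in\mathcal{K}_o^n$: the support function is $h_K(v)=\max\{x\cdot v:x\in K\}$ and the radial function is $\rho_K(u)=\max\{\lambda:\lambda u\in K\}$, for $u,v\in S^{n-1}$. For a Borel set $\omega\subset S^{n-1}$ the radial Gauss image is $$\boldsymbol{\alpha}_K(\omega)=\{v\in S^{n-1}: v\cdot u\,\rho_K(u)=h_K(v)\text{ for some }u\in\omega\}.$$ The Aleksandrov integral curvature of $K$ is the Borel measure on $S^{n-1}$ given by $J(K,\omega)=\mathcal{H}^{n-1}(\boldsymbol{\alpha}_K(\omega))$, where $\mathcal{H}^{n-1}$ is $(n-1)$-dimensional Hausdorff measure. For $p\in\mathbb{R}$, the $L_p$ Aleksandrov integral curvature of $K$ is the Borel measure $J_p(K,\cdot)$ on $S^{n-1}$ given by $dJ_p(K,\cdot)=\rho_K^{\,p}\,dJ(K,\cdot)$. A measure $\mu$ on $S^{n-1}$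 is even if $\mu(\omega)=\mu(-\omega)$ for every Borel set $\omega$. Discrete means that the support of $\mu$ is a finite set $\{\pm u_1,\dots,\pm u_N\}$. A great subsphere is a set $S^{n-1}\cap u^\perp$ with $u\in S^{n-1}$; $\mu$ is concentrated entirely on it if $\mu(S^{n-1}\setminus u^\perp)=0$. *)

(* Defs.v *)
From HB Require Import structures.
From mathcomp Require Import all_boot all_order all_algebra.
From mathcomp Require Import all_classical all_reals all_analysis.

Set Implicit Arguments.
Unset Strict Implicit.
Unset Printing Implicit Defensive.

Import Order.TTheory GRing.Theory Num.Theory.
Import numFieldNormedType.Exports.

Local Open Scope classical_set_scope.
Local Open Scope ring_scope.

(* The library norm on row vectors is the sup norm.  It induces the usual
   topology, but Euclidean lengths have to be defined separately. *)
Definition dot (R : realType) (m : nat) (x y : 'rV[R]_m) : R :=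
  \sum_i x 0 i * y 0 i.

Definition enorm (R : realType) (m : nat) (x : 'rV[R]_m) : R :=
  Num.sqrt (dot x x).

Section Hausdorff.
Context (R : realType) (m : nat).
Local Open Scope ereal_scope.

(* [diam set0 = -oo]; [hausdorff_gauge] treats the empty set apart. *)
Definition diam (U : set 'rV[R]_m) : \bar R :=
  ereal_sup [set (enorm (x - y))%:E | x in U & y in U].

(* Volume of the unit ball of R^k, i.e. pi^(k/2) / Gamma (k/2 + 1). *)
Fixpoint ball_volume (k : nat) : R :=
  match k with
  | 0 => 1
  | 1 => 2
  | (j.+1 as i).+1 => 2 * pi / i.+1%:R * ball_volume j
  end%R.

(* The empty set has gauge 0 also when [k = 0], so that the 0-dimensional
   measure is the counting measure. *)
Definition hausdorff_gauge (k : nat) (U : set 'rV[R]_m) : \bar R :=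
  if U == set0 then 0 else (ball_volume k)%:E * (2^-1%:E * diam U) ^+ k.

Definition hausdorff_cover (delta : R) (A : set 'rV[R]_m)
    (F : (set 'rV[R]_m)^nat) : Prop :=
  A `<=` \bigcup_i F i /\ forall i, diam (F i) <= delta%:E.

Definition hausdorff_content (k : nat) (delta : R) (A : set 'rV[R]_m)
    : \bar R :=
  ereal_inf [set \sum_(i <oo) hausdorff_gauge k (F i)
            | F in hausdorff_cover delta A].

Definition hausdorff (k : nat) (A : set 'rV[R]_m) : \bar R :=
  ereal_sup [set hausdorff_content k delta A
            | delta in [set delta : R | (0 < delta)%R]].

End Hausdorff.

(* The ambient space is R^(n+1), so that the sphere, which has dimension n,
   is never empty; measurable types have to be pointed. *)
Section Sphere.
Context (R : realType) (n : nat).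

Definition unit_sphere : set 'rV[R]_n.+1 := [set x | enorm x = 1].

Definition sphere : Type := set_type unit_sphere.

Lemma delta_in_sphere : delta_mx 0 0 \in unit_sphere.
Proof.
rewrite inE /unit_sphere /= /enorm /dot big_ord_recl big1 => [|i _].
  by rewrite !mxE !eqxx /= mulr1 addr0 sqrtr1.
by rewrite !mxE /= mul0r.
Qed.

HB.instance Definition _ :=
  Topological.copy sphere (set_type unit_sphere).
HB.instance Definition _ :=
  isPointed.Build sphere (SigSub delta_in_sphere : set_type unit_sphere).

Definition borel_sphere : measurableType (@open sphere).-sigma :=
  g_sigma_algebraType (@open sphere).

Definition antipodal (w : set sphere) : set sphere :=
  [set v | exists2 u, w u & \val v = - \val u].

Definition great_subsphere (u : sphere) : set sphere :=
  [set v | dot (\val v) (\val u) = 0].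

End Sphere.

Section ConvexBodies.
Context (R : realType) (n : nat).
Implicit Types K : set 'rV[R]_n.+1.

Definition convex_body K : Prop :=
  [/\ compact K, convex_set K & K° !=set0].

Definition convex_body_o K : Prop := convex_body K /\ K° 0.

Definition convex_body_e K : Prop := convex_body_o K /\ K = -%R @` K.

Definition convex_hull (A : set 'rV[R]_n.+1) : set 'rV[R]_n.+1 :=
  smallest (@convex_set R 'rV[R]_n.+1) A.

Definition polytope K : Prop :=
  exists2 A : set 'rV[R]_n.+1, finite_set A & K = convex_hull A.

(* For [K] in [convex_body_o] the two suprema are attained. *)
Definition support_fun K (v : sphere R n) : R :=
  sup [set dot x (\val v) | x in K].

Definition radial_fun K (u : sphere R n) : R :=
  sup [set lambda : R | K (lambda *: \val u)].

Definition radial_Gauss_image K (w : set (sphere R n)) : set (sphere R n) :=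
  [set v | exists2 u, w u &
    dot (\val v) (\val u) * radial_fun K u = support_fun K v].

Definition integral_curvature K (w : set (borel_sphere R n)) : \bar R :=
  hausdorff n (\val @` radial_Gauss_image K w).

(* The library integral takes an arbitrary set function as integrator, so
   countable additivity of [integral_curvature K] is not needed to state it. *)
Definition Lp_integral_curvature (p : R) K (w : set (borel_sphere R n))
    : \bar R :=
  (\int[integral_curvature K]_(u in w) (radial_fun K u `^ p)%:E)%E.

End ConvexBodies.

Section Measures.
Context (R : realType) (n : nat).
Local Open Scope ereal_scope.
Variable mu : {finite_measure set (borel_sphere R n) -> \bar R}.

(* Measures are total functions in the library; only their values on
   measurable sets are meaningful. *)
Definition nonzero_measure : Prop :=
  exists2 w : set (borel_sphere R n), measurable w & mu w != 0.

Definition even_measure : Prop :=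
  forall w : set (borel_sphere R n), measurable w -> mu w = mu (antipodal w).

Definition measure_support : set (sphere R n) :=
  [set u | forall U : set (sphere R n), open U -> U u -> 0 < mu U].

Definition discrete_measure : Prop := finite_set measure_support.

Definition concentrated_on (S : set (sphere R n)) : Prop := mu (~` S) = 0.

End Measures.

(* Main.v *)
(** Write q = - p, let +-u_i carry the masses m_i of mu, and look for K as the
    convex hull of the points +-exp(x_i) u_i.  Up to a null set, the radial Gauss
    image of a set of directions is the union of the normal cones of K at the
    vertices it contains, so J(K, .) is a sum of point masses and the equation
    says that the normal cones at +-exp(x_i) u_i have measure m_i exp(q x_i).

    With h_x the support function of K and sigma the spherical measure, consider
      G(x) = int log (h_x / h_0) d sigma - sigma(S) / q * log (sum_i m_i exp(q x_i)),
    which is invariant under adding a constant to all coordinates.  On a large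
    box [-L, 0]^N it has a minimiser, which stays away from the face x_i = -L
    because a strip {|u . v| <= e} of the sphere has measure O(e) and q < 1.
    Increasing x_i by t > 0 changes h_x only on the new cell of normals at
    +-exp(x_i) u_i; letting t tend to 0, minimality bounds the measure of this
    cell below by sigma(S) m_i exp(q x_i) / sum_j m_j exp(q x_j).  These bounds
    add up to sigma(S), so they are equalities, and a shift of x normalises the
    constant.

    Conversely, if K has interior around 0, then every normal close to a unit
    vector u is attained at a point of the boundary off the hyperplane orthogonal
    to u, so the curvature of the complement of a great subsphere is positive.

    On the Hausdorff side, covers by grid boxes bound the measure of strips
    above, which in turn makes half-spaces Caratheodory measurable, and
    integrating the inequality between indicator functions expressed by a cover
    bounds the measure of open sets below. *)

From HB Require Import structures.
Require Import Defs.
From mathcomp Require Import all_boot all_order all_algebra.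
From mathcomp Require Import all_classical all_reals all_analysis.
From mathcomp Require Import measurable_realfun ring lra.

Set Implicit Arguments.
Unset Strict Implicit.
Unset Printing Implicit Defensive.

Import Order.TTheory GRing.Theory Num.Theory.
Import numFieldNormedType.Exports.

Local Open Scope classical_set_scope.
Local Open Scope ring_scope.

(** * Euclidean inner product and norm, and comparison with the sup norm *)

Section Euclid.
Context {R : realType} {m : nat}.
Implicit Types (x y z : 'rV[R]_m) (a : R).

Lemma dotC x y : dot x y = dot y x.
Proof. by apply: eq_bigr => i _; rewrite mulrC. Qed.

Lemma dotDl x y z : dot (x + y) z = dot x z + dot y z.
Proof. by rewrite -big_split; apply: eq_bigr => i _; rewrite !mxE mulrDl. Qed.

Lemma dotZl a x y : dot (a *: x) y = a * dot x y.
Proof. by rewrite mulr_sumr; apply: eq_bigr => i _; rewrite !mxE mulrA. Qed.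

Lemma dotNl x y : dot (- x) y = - dot x y.
Proof. by rewrite -scaleN1r dotZl mulN1r. Qed.

Lemma dotBl x y z : dot (x - y) z = dot x z - dot y z.
Proof. by rewrite dotDl dotNl. Qed.

Lemma dotDr x y z : dot x (y + z) = dot x y + dot x z.
Proof. by rewrite dotC dotDl !(dotC x). Qed.

Lemma dotZr a x y : dot x (a *: y) = a * dot x y.
Proof. by rewrite dotC dotZl dotC. Qed.

Lemma dotNr x y : dot x (- y) = - dot x y.
Proof. by rewrite dotC dotNl dotC. Qed.

Lemma dotBr x y z : dot x (y - z) = dot x y - dot x z.
Proof. by rewrite dotDr dotNr. Qed.

Lemma dot0l x : dot 0 x = 0.
Proof. by rewrite -(scale0r x) dotZl mul0r. Qed.

Lemma dot_sumr (I : Type) (r : seq I) (P : pred I) (F : I -> 'rV[R]_m) x :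
  dot x (\sum_(i <- r | P i) F i) = \sum_(i <- r | P i) dot x (F i).
Proof.
elim/big_rec2: _ => [|i a b _ <-]; last by rewrite dotDr.
by rewrite dotC dot0l.
Qed.

Lemma dot_delta x i : dot x (delta_mx 0 i) = x 0 i.
Proof.
rewrite /dot (bigD1 i) //= big1 => [|j ji]; rewrite !mxE !eqxx ?mulr1 ?addr0 //.
by rewrite (negbTE ji) andbF mulr0.
Qed.

Lemma dot_ge0 x : 0 <= dot x x.
Proof. by apply: sumr_ge0 => i _; rewrite -expr2 sqr_ge0. Qed.

Lemma dot_eq0 x : (dot x x == 0) = (x == 0).
Proof.
apply/idP/eqP => [|->]; last by rewrite dot0l.
rewrite psumr_eq0 => [/allP xx0|i _]; last by rewrite -expr2 sqr_ge0.
apply/rowP => i; rewrite mxE; apply/eqP.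
by have := xx0 i (mem_index_enum _); rewrite /= mulf_eq0 orbb.
Qed.

Lemma enorm_ge0 x : 0 <= enorm x.
Proof. exact: sqrtr_ge0. Qed.

Lemma sqr_enorm x : enorm x ^+ 2 = dot x x.
Proof. by rewrite sqr_sqrtr // dot_ge0. Qed.

Lemma enorm_eq0 x : (enorm x == 0) = (x == 0).
Proof. by rewrite -dot_eq0 -sqr_enorm sqrf_eq0. Qed.

Lemma enorm_gt0 x : (0 < enorm x) = (x != 0).
Proof. by rewrite lt_neqAle enorm_ge0 andbT eq_sym enorm_eq0. Qed.

Lemma enormZ a x : enorm (a *: x) = `|a| * enorm x.
Proof.
by rewrite /enorm dotZl dotZr mulrA -expr2 sqrtrM ?sqr_ge0 // sqrtr_sqr.
Qed.

Lemma enormN x : enorm (- x) = enorm x.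
Proof. by rewrite /enorm dotNl dotNr opprK. Qed.

Lemma enormBC x y : enorm (x - y) = enorm (y - x).
Proof. by rewrite -enormN opprB. Qed.

(** Cauchy-Schwarz, read off from the nonnegative squared length of
    [dot y y *: x - dot x y *: y]. *)
Lemma dot_le_enorm x y : dot x y <= enorm x * enorm y.
Proof.
have [->|y0] := eqVneq y 0; first by rewrite dotC dot0l mulr_ge0 ?enorm_ge0.
have y_gt0 : 0 < dot y y by rewrite lt_neqAle dot_ge0 eq_sym dot_eq0 y0.
have := dot_ge0 (dot y y *: x - dot x y *: y).
rewrite dotBl !dotBr !dotZl !dotZr (dotC y x) => h.
have {}h : dot x y ^+ 2 <= dot x x * dot y y by nra.
apply: le_trans (ler_norm _) _.
rewrite -(ler_pXn2r (ltn0Sn 1)) ?nnegrE ?mulr_ge0 ?enorm_ge0 //.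
by rewrite real_normK ?num_real // exprMn !sqr_enorm.
Qed.

Lemma norm_dot_le x y : `|dot x y| <= enorm x * enorm y.
Proof. by rewrite ler_norml lerNl -dotNl -{1}(enormN x) !dot_le_enorm. Qed.

Lemma ler_enormD x y : enorm (x + y) <= enorm x + enorm y.
Proof.
rewrite -(ler_pXn2r (ltn0Sn 1)) ?nnegrE ?addr_ge0 ?enorm_ge0 //.
rewrite sqrrD !sqr_enorm dotDl !dotDr (dotC y x).
by have := dot_le_enorm x y; lra.
Qed.

Lemma coord_le_enorm x i : `|x 0 i| <= enorm x.
Proof.
rewrite -(ler_pXn2r (ltn0Sn 1)) ?nnegrE ?enorm_ge0 //.
rewrite real_normK ?num_real // sqr_enorm /dot (bigD1 i) //= expr2 lerDl.
by apply: sumr_ge0 => j _; rewrite -expr2 sqr_ge0.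
Qed.

Lemma enorm_le_sum x : enorm x <= \sum_i `|x 0 i|.
Proof.
rewrite [in leLHS](row_sum_delta x); elim/big_ind2: _ => [|a b c d ab cd|i _].
- by rewrite /enorm dot0l sqrtr0.
- exact: le_trans (ler_enormD _ _) (lerD ab cd).
- by rewrite enormZ /enorm dot_delta mxE !eqxx sqrtr1 mulr1.
Qed.

Lemma coord_le_norm x i : `|x 0 i| <= `|x|.
Proof.
rewrite [leRHS]/Num.norm /= mx_normrE.
by apply/bigmax_geP; right; exists (0, i).
Qed.

Lemma norm_le_enorm x : `|x| <= enorm x.
Proof.
rewrite [leLHS]/Num.norm /= mx_normrE; apply/bigmax_leP; split=> [|[i j] _ /=].
  exact: enorm_ge0.
by rewrite ord1 coord_le_enorm.
Qed.

Lemma enorm_le_norm x : enorm x <= m%:R * `|x|.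
Proof.
apply: le_trans (enorm_le_sum x) _; 
have -> : m%:R * `|x| = \sum_(i < m) `|x| by rewrite sumr_const card_ord mulr_natl.
by apply: ler_sum => i _; exact: coord_le_norm.
Qed.

End Euclid.

Lemma lipschitz_continuous (R : realType) (V W : normedModType R) (f : V -> W)
    (C : R) :
  (forall x y, `|f x - f y| <= C * `|x - y|) -> continuous f.
Proof.
move=> fC x; apply/cvgrPdist_lt => e e0.
have C0 : 0 < `|C| + 1 by rewrite ltr_wpDl.
near=> y; apply: le_lt_trans (fC _ _) _.
apply: (@le_lt_trans _ _ ((`|C| + 1) * `|x - y|)).
  by rewrite ler_wpM2r // (le_trans (ler_norm _)) // lerDl.
rewrite mulrC -ltr_pdivlMr //; near: y.
by apply/nbhs_normP; exists (e / (`|C| + 1)) => //=; rewrite divr_gt0.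
Unshelve. all: by end_near. Qed.

Lemma continuous_dotl (R : realType) (m : nat) (y : 'rV[R]_m) :
  continuous (fun x => dot x y).
Proof.
apply: (@lipschitz_continuous _ _ R^o _ (m%:R * enorm y)) => x x'.
rewrite -dotBl; apply: le_trans (norm_dot_le _ _) _.
by rewrite [leRHS]mulrAC ler_wpM2r ?enorm_ge0 // enorm_le_norm.
Qed.

(** * Outer Hausdorff measures *)

Section HausdorffOuter.
Context {R : realType} {m : nat}.
Implicit Types (A B U : set 'rV[R]_m) (F : (set 'rV[R]_m)^nat).
Local Open Scope ereal_scope.

Lemma ball_volume_gt0 k : (0 < ball_volume R k)%R.
Proof.
suff : (0 < ball_volume R k)%R /\ (0 < ball_volume R k.+1)%R by case.
elim: k => [|k [k0 k1]]; first by split.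
by split=> //; rewrite [ball_volume R k.+2]/= mulr_gt0 // divr_gt0 // mulr_gt0 // pi_gt0.
Qed.

Lemma le_diam A x y : A x -> A y -> (enorm (x - y))%:E <= diam A.
Proof. by move=> Ax Ay; apply: ereal_sup_ubound; exists x => //; exists y. Qed.

Lemma diam_le A (d : R) :
  (forall x y, A x -> A y -> (enorm (x - y) <= d)%R) -> diam A <= d%:E.
Proof. by move=> h; apply: ge_ereal_sup => _ [x Ax [y Ay <-]]; rewrite lee_fin h. Qed.

Lemma diam_ge0 A : A !=set0 -> 0 <= diam A.
Proof.
by case=> x Ax; apply: le_trans (le_diam Ax Ax); rewrite lee_fin enorm_ge0.
Qed.

Lemma diam_set0 : diam (set0 : set 'rV[R]_m) = -oo.
Proof.
rewrite /diam (_ : [set _ | _ in _ & _ in _] = set0) ?ereal_sup0 //.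
by apply/seteqP; split => // x [].
Qed.

Lemma hausdorff_gauge0 k : hausdorff_gauge k (set0 : set 'rV[R]_m) = 0.
Proof. by rewrite /hausdorff_gauge eqxx. Qed.

Lemma hausdorff_gauge_ge0 k A : 0 <= hausdorff_gauge k A.
Proof.
rewrite /hausdorff_gauge; case: eqP => // /eqP/set0P A0.
apply: mule_ge0; first by rewrite lee_fin ltW ?ball_volume_gt0.
by apply/expe_ge0/mule_ge0 => //; exact: diam_ge0.
Qed.

Lemma hausdorff_gauge_le k A (d : R) : (0 <= d)%R -> diam A <= d%:E ->
  hausdorff_gauge k A <= (ball_volume R k * (2^-1 * d) ^+ k)%:E.
Proof.
move=> d0 Ad; rewrite /hausdorff_gauge; case: eqP => [_|/eqP/set0P A0].
  by rewrite lee_fin mulr_ge0 ?exprn_ge0 ?mulr_ge0 ?invr_ge0 // ltW ?ball_volume_gt0.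
have := diam_ge0 A0; case: (diam A) Ad => // r; rewrite !lee_fin => rd r0.
rewrite -EFinM -EFin_expe -EFinM lee_fin ler_wpM2l //; first exact/ltW/ball_volume_gt0.
by apply: lerXn2r; rewrite ?nnegrE ?mulr_ge0 ?ler_wpM2l.
Qed.

Lemma hausdorff_content_ge0 k (d : R) A : 0 <= hausdorff_content k d A.
Proof.
apply: le_ereal_inf_tmp => _ [F _ <-].
by apply: nneseries_ge0 => i _ _; exact: hausdorff_gauge_ge0.
Qed.

Lemma hausdorff_content_le k (d : R) A F : hausdorff_cover d A F ->
  hausdorff_content k d A <= \sum_(i <oo) hausdorff_gauge k (F i).
Proof. by move=> AF; apply: ereal_inf_lbound; exists F. Qed.

Lemma hausdorff_contentS k (d : R) A B :
  A `<=` B -> hausdorff_content k d A <= hausdorff_content k d B.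
Proof.
move=> AB; apply: ereal_inf_le_tmp => _ [F [BF dF] <-]; exists F => //.
by split => //; exact: subset_trans BF.
Qed.

Lemma le_hausdorff_content k (d e : R) A : (d <= e)%R ->
  hausdorff_content k e A <= hausdorff_content k d A.
Proof.
move=> de; apply: ereal_inf_le_tmp => _ [F [AF dF] <-]; exists F => //.
by split => // i; apply: le_trans (dF i) _; rewrite lee_fin.
Qed.

(** Covers of the [A n] that are optimal up to e / 2^(n+1) are merged into a single sequence along a
    bijection between nat and nat * nat. *)
Lemma hausdorff_content_sigma_subadditive k (d : R) :
  sigma_subadditive (@hausdorff_content R m k d).
Proof.
move=> A; have [[i ioo]|] := pselect (exists i, hausdorff_content k d (A i) = +oo).
  rewrite (eseries_pinfty _ _ ioo) ?leey// => n _.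
  by rewrite -ltNye (lt_le_trans _ (hausdorff_content_ge0 _ _ _)).
rewrite -forallNE => Aoo.
apply/lee_addgt0Pr => e e0.
rewrite (le_trans _ (epsilon_trick _ _ _)) //; last 2 first.
- by move=> n; exact: hausdorff_content_ge0.
- exact: ltW.
pose P n (B : (set 'rV[R]_m)^nat) := hausdorff_cover d (A n) B /\
  \sum_(k0 <oo) hausdorff_gauge k (B k0)
    <= hausdorff_content k d (A n) + (e / (2 ^ n.+1)%:R)%:E.
have [G PG] : {G : ((set 'rV[R]_m)^nat)^nat & forall n, P n (G n)}.
  apply: (@choice _ _ P) => n.
  have fin : hausdorff_content k d (A n) \is a fin_num.
    by rewrite ge0_fin_numE ?hausdorff_content_ge0 // ltey; apply/eqP/Aoo.
  have en : (0 < e / (2 ^ n.+1)%:R)%R by rewrite divr_gt0 // ltr0n expn_gt0.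
  have [_ [B AB <-] lt] := lb_ereal_inf_adherent en fin.
  by exists B; split => //; exact: ltW.
apply: (@le_trans _ _ (\sum_(i <oo) \sum_(j <oo) hausdorff_gauge k (G i j))); last first.
  apply: lee_nneseries => [n _ _|n _]; last exact: (PG n).2.
  by apply: nneseries_ge0 => j _ _; exact: hausdorff_gauge_ge0.
rewrite nneseries_esumT; last first.
  by move=> i; apply: nneseries_ge0 => j _ _; exact: hausdorff_gauge_ge0.
under eq_esum => i _.
  rewrite nneseries_esumT; last by move=> j; exact: hausdorff_gauge_ge0.
  over.
rewrite esum_esum; last by move=> i j _ _; exact: hausdorff_gauge_ge0.
have /card_esym/ppcard_eqP[f] := card_nat2.
rewrite (reindex_esum [set: nat] _ f); last first.
  rewrite (_ : _ `*`` _ = setT); first exact: bij.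
  by apply/seteqP; split => // -[].
rewrite -nneseries_esumT; last by move=> n; exact: hausdorff_gauge_ge0.
apply: (@hausdorff_content_le k d _ (fun n => G (f n).1 (f n).2)).
split=> [x [i _ Aix]|i]; last exact: (PG _).1.2.
have [j _ Gij] := (PG i).1.1 x Aix.
by exists (f^-1%FUN (i, j)) => //=; rewrite invK ?inE.
Qed.

Lemma hausdorff_content_le_hausdorff k (d : R) A : (0 < d)%R ->
  hausdorff_content k d A <= hausdorff k A.
Proof. by move=> d0; apply: ereal_sup_ubound; exists d. Qed.

Lemma hausdorff_ge0 k A : 0 <= hausdorff k A.
Proof.
apply: le_trans (@hausdorff_content_le_hausdorff k 1%R A ltr01).
exact: hausdorff_content_ge0.
Qed.

Lemma le_hausdorff k A B : A `<=` B -> hausdorff k A <= hausdorff k B.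
Proof.
move=> AB; apply: ge_ereal_sup => _ [d d0 <-].
exact: le_trans (hausdorff_contentS _ _ AB) (hausdorff_content_le_hausdorff _ _ d0).
Qed.

Lemma hausdorff_set0 k : hausdorff k (set0 : set 'rV[R]_m) = 0.
Proof.
apply/eqP; rewrite eq_le hausdorff_ge0 andbT.
apply: ge_ereal_sup => _ [d d0 <-].
apply: le_trans (@hausdorff_content_le k d _ (fun=> set0) _) _.
  by split=> // i; rewrite diam_set0 leNye.
by rewrite eseries0 // => i _ _; exact: hausdorff_gauge0.
Qed.

Lemma hausdorff_sigma_subadditive k : sigma_subadditive (@hausdorff R m k).
Proof.
move=> A; apply: ge_ereal_sup => _ [d d0 <-].
apply: le_trans (hausdorff_content_sigma_subadditive _ _ _) _.
apply: lee_nneseries => i _; first by move=> _; exact: hausdorff_content_ge0.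
exact: hausdorff_content_le_hausdorff.
Qed.

(** A piece of diameter at most [d] cannot meet both sets, so every cover of the union splits into a
    cover of [A] and a cover of [B]. *)
Lemma hausdorff_contentD_separated k (d : R) A B :
  (forall x y, A x -> B y -> (d < enorm (x - y))%R) ->
  hausdorff_content k d A + hausdorff_content k d B
    <= hausdorff_content k d (A `|` B).
Proof.
move=> AB; apply: le_ereal_inf_tmp => _ [F [ABF dF] <-].
(* Pieces that miss [C] are emptied, so that they cost nothing. *)
pose G (C : set 'rV[R]_m) i := if pselect (F i `&` C !=set0) then F i else set0.
have Gcov C : C `<=` A `|` B -> hausdorff_cover d C (G C).
  move=> CAB; split=> [x Cx|i].
    have [i _ Fix] := ABF x (CAB x Cx); exists i => //.
    by rewrite /G; case: pselect => // -[]; exists x.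
  by rewrite /G; case: pselect => ?; [exact: dF|rewrite diam_set0 leNye].
have GA := Gcov A (@subsetUl _ _ _).
have GB := Gcov B (@subsetUr _ _ _).
apply: le_trans (leeD (hausdorff_content_le k GA) (hausdorff_content_le k GB)) _.
rewrite -nneseriesD; last 2 first.
- by move=> i _ _; exact: hausdorff_gauge_ge0.
- by move=> i _ _; exact: hausdorff_gauge_ge0.
apply: lee_nneseries => i _.
  by move=> _; rewrite adde_ge0 // hausdorff_gauge_ge0.
rewrite /G; case: (pselect (F i `&` A !=set0)) => [[x [Fx Ax]]|?];
  case: (pselect (F i `&` B !=set0)) => [[y [Fy By]]|?]; rewrite ?hausdorff_gauge0 ?add0e ?adde0 //; last exact: hausdorff_gauge_ge0.
have := le_trans (le_diam Fx Fy) (dF i).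
by rewrite lee_fin leNgt AB.
Qed.

(** Contents grow as the scale shrinks, so the contents of [A] and [B] at scales [e1] and [e2] can
    both be compared at the common scale [e], which is also at most [d]. *)
Lemma hausdorffD_separated k (d : R) A B : (0 < d)%R ->
  hausdorff k A < +oo -> hausdorff k B < +oo ->
  (forall x y, A x -> B y -> (d < enorm (x - y))%R) ->
  hausdorff k A + hausdorff k B <= hausdorff k (A `|` B).
Proof.
move=> d0 Aoo Boo AB.
have Af : hausdorff k A \is a fin_num by rewrite ge0_fin_numE ?hausdorff_ge0.
have Bf : hausdorff k B \is a fin_num by rewrite ge0_fin_numE ?hausdorff_ge0.
rewrite -leeBrDr //; apply: ge_ereal_sup => _ [e1 /= e10 <-].
rewrite leeBrDr // addeC; rewrite -leeBrDr; last first.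
  rewrite ge0_fin_numE ?hausdorff_content_ge0 //.
  exact: le_lt_trans (hausdorff_content_le_hausdorff _ _ e10) Aoo.
apply: ge_ereal_sup => _ [e2 /= e20 <-]; rewrite leeBrDr; last first.
  rewrite ge0_fin_numE ?hausdorff_content_ge0 //.
  exact: le_lt_trans (hausdorff_content_le_hausdorff _ _ e10) Aoo.
pose e := Num.min d (Num.min e1 e2).
have e0 : (0 < e)%R by rewrite !lt_min d0 e10 e20.
apply: le_trans (hausdorff_content_le_hausdorff k (A `|` B) e0).
have AB' x y : A x -> B y -> (e < enorm (x - y))%R.
  by move=> Ax By; rewrite gt_min AB.
apply: le_trans (hausdorff_contentD_separated k AB').
by rewrite addeC leeD // le_hausdorff_content // !ge_min lexx ?orbT.
Qed.

(** A map that does not increase distances sends covers to covers with no larger diameters. *)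
Lemma hausdorff_image_le k A B (f : 'rV[R]_m -> 'rV[R]_m) :
  (forall x y, (enorm (f x - f y) <= enorm (x - y))%R) -> B `<=` f @` A ->
  hausdorff k B <= hausdorff k A.
Proof.
move=> f1 BfA; apply: ge_ereal_sup => _ [d d0 <-].
apply: le_trans (hausdorff_content_le_hausdorff k A d0).
apply: le_ereal_inf_tmp => _ [F [AF dF] <-].
have df U : diam (f @` U) <= diam U.
  apply: ge_ereal_sup => _ [_ [x Ux <-] [_ [y Uy <-] <-]].
  by apply: le_trans (le_diam Ux Uy); rewrite lee_fin.
apply: le_trans (@hausdorff_content_le k d _ (fun i => f @` F i) _) _.
  split=> [x /BfA[y Ay <-]|i]; last exact: le_trans (df _) (dF i).
  by have [i _ Fiy] := AF y Ay; exists i => //; exists y.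
apply: lee_nneseries => i _; first by move=> _; exact: hausdorff_gauge_ge0.
rewrite /hausdorff_gauge; have [->|Fi0] := eqVneq (F i) set0.
  by rewrite image_set0 eqxx.
have /set0P[x Fix] := Fi0; case: eqP => [fF|_].
  have : (f @` F i) (f x) by exists x.
  by rewrite fF.
apply: lee_pmul => //; first by rewrite lee_fin ltW ?ball_volume_gt0.
  by apply/expe_ge0/mule_ge0 => //; apply: diam_ge0; exists (f x), x.
have : 0 <= diam (f @` F i) by apply: diam_ge0; exists (f x), x.
(* Monotonicity of powers for extended reals, by induction on the exponent. *)
elim: k => // k IH f0; rewrite !expeS; apply: lee_pmul => //; last exact: IH.
- exact: mule_ge0.
- by apply/expe_ge0/mule_ge0.
- by apply: lee_pmul.
Qed.

Lemma hausdorff_content_fincover k (d : R) A (I : finType)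
    (F : I -> set 'rV[R]_m) :
  A `<=` \bigcup_i F i -> (forall i, diam (F i) <= d%:E) ->
  hausdorff_content k d A <= \sum_i hausdorff_gauge k (F i).
Proof.
move=> AF dF.
pose G n := if insub n is Some i then F (enum_val (i : 'I_#|I|)) else set0.
apply: le_trans (@hausdorff_content_le k d A G _) _.
  split=> [x /AF[i _ Fix]|n]; last first.
    by rewrite /G; case: insub => [i|]; rewrite ?diam_set0 ?leNye.
  exists (enum_rank i : nat) => //.
  by rewrite /G insubT // => h; rewrite [Sub _ _](_ : _ = enum_rank i) ?enum_rankK //; exact: val_inj.
rewrite (nneseries_split 0 #|I|); last by move=> *; exact: hausdorff_gauge_ge0.
rewrite add0n [X in _ + X]eseries0 ?adde0; last first.
  by move=> i Ii _; rewrite /G insubF ?hausdorff_gauge0 // ltnNge Ii.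
rewrite big_mkord [leRHS](reindex_onto (@enum_val I _) enum_rank) /=; last first.
  by move=> i _; rewrite enum_rankK.
rewrite [leRHS](eq_bigl xpredT) => [|i]; last by rewrite enum_valK eqxx.
by apply: lee_sum => i _; rewrite /G valK.
Qed.

End HausdorffOuter.

HB.instance Definition _ (R : realType) (m k : nat) :=
  isOuterMeasure.Build R 'rV[R]_m (@hausdorff R m k)
    (@hausdorff_set0 R m k) (@hausdorff_ge0 R m k) (@le_hausdorff R m k)
    (@hausdorff_sigma_subadditive R m k).

(** * Hausdorff measure on the sphere *)

Lemma outer_measure_fincover (R : realType) (T : Type)
    (mu : {outer_measure set T -> \bar R}) (I : finType) (A : set T)
    (F : I -> set T) :
  A `<=` \bigcup_i F i -> (mu A <= \sum_i mu (F i))%E.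
Proof.
move=> AF; apply: (@le_trans _ _ (mu (\big[setU/set0]_(i <- index_enum I) F i))).
  apply: le_outer_measure => x /AF[i _ Fix]; rewrite -bigcup_seq.
  by exists i => //=; exact: mem_index_enum.
elim/big_rec2: _ => [|i y A' _ IH]; first by rewrite outer_measure0.
exact: le_trans (outer_measureU2 _ _ _) (leeD _ IH).
Qed.

Lemma truncn_eq_dist (R : realType) (x y : R) : 0 <= x -> 0 <= y ->
  Num.truncn x = Num.truncn y -> `|x - y| <= 1.
Proof.
move=> x0 y0 xy; have := truncn_itv x0; have := truncn_itv y0; rewrite xy -natr1.
move=> /andP[? ?] /andP[? ?]; rewrite ler_norml; lra.
Qed.

(** * Upper bounds from grid covers: boxes, strips and great subspheres *)

Section SphereCover.
Context {R : realType} {n : nat}.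
Implicit Types (v w : 'rV[R]_n.+1) (j : 'I_n.+1).
Local Notation S := (unit_sphere (R := R) (n := n)).

Lemma unit_sphere_dot v : S v -> dot v v = 1.
Proof. by move=> vS; rewrite -sqr_enorm vS expr1n. Qed.

Lemma coord_unit_sphere v j : S v -> `|v 0 j| <= 1.
Proof. by move=> <-; exact: coord_le_enorm. Qed.

(** With the threshold 1 / (n + 1) these caps cover the sphere: coordinates of absolute value below
    it would have squares adding up to less than 1. *)
Definition cap (s : bool) j : set 'rV[R]_n.+1 :=
  [set v | S v /\ n.+1%:R^-1 <= (-1) ^+ s * v 0 j].

Lemma sphere_cap v : S v -> exists s j, cap s j v.
Proof.
move=> vS; suff [j vj] : exists j, n.+1%:R^-1 <= `|v 0 j|.
  by exists (v 0 j < 0), j; split => //; rewrite -normrEsign ?num_real.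
apply: contrapT => /forallNP vlt.
suff : dot v v < 1 by rewrite unit_sphere_dot // ltxx.
have -> : 1 = \sum_(j < n.+1) n.+1%:R^-1 :> R.
  by rewrite sumr_const card_ord -(mulr_natl (n.+1%:R^-1)) mulfV.
apply: ltr_sum; first by apply/hasP; exists 0; rewrite ?mem_index_enum.
move=> j _; have /negP := vlt j; rewrite -ltNge; apply: le_lt_trans.
rewrite -expr2 -real_normK ?num_real // expr2 ler_piMr //.
exact: coord_unit_sphere.
Qed.

(* On a cap the coordinate [j] is a Lipschitz function of the others. *)
Lemma cap_enormB s j (e : R) v w : cap s j v -> cap s j w ->
  (forall k, `|v 0 (lift j k) - w 0 (lift j k)| <= e) ->
  enorm (v - w) <= (n * n.+2)%:R * e.
Proof.
move=> [vS vj] [wS wj] vw.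
have sum_e : \sum_(k < n) e = n%:R * e by rewrite sumr_const card_ord mulr_natl.
apply: le_trans (enorm_le_sum _) _; rewrite (bigD1_ord j) //=.
have tail : \sum_(k < n) `|(v - w) 0 (lift j k)| <= n%:R * e.
  by rewrite -sum_e; apply: ler_sum => k _; rewrite !mxE.
(* The sphere equation bounds the difference of the squares of the [j]-th coordinates by 2 n e.
   Dividing by their sum, which is at least 2 / (n + 1) in absolute value because both have the sign
   of the cap, bounds the difference itself. *)
have head : `|v 0 j - w 0 j| <= (n * n.+1)%:R * e.
  have abs2 : `|v 0 j ^+ 2 - w 0 j ^+ 2| <= 2 * n%:R * e.
    have := unit_sphere_dot vS; have := unit_sphere_dot wS.
    rewrite /dot !(bigD1_ord j) //= => ww vv.
    have -> : v 0 j ^+ 2 - w 0 j ^+ 2 = \sum_(k < n)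
        (w 0 (lift j k) * w 0 (lift j k) - v 0 (lift j k) * v 0 (lift j k)).
      by rewrite sumrB; lra.
    apply: le_trans (ler_norm_sum _ _ _) _.
    rewrite -mulrA -sum_e mulr_sumr; apply: ler_sum => k _.
    rewrite -!expr2 subr_sqr normrM mulrC ler_pM //; last by rewrite distrC.
    apply: le_trans (ler_normD _ _) _.
    by rewrite (_ : 2 = 1 + 1) // lerD // coord_unit_sphere.
  have lb : 2 * n.+1%:R^-1 <= `|v 0 j + w 0 j|.
    have <- : `|(-1) ^+ s * (v 0 j + w 0 j)| = `|v 0 j + w 0 j|.
      by rewrite normrM normrX normrN1 expr1n mul1r.
    by apply: le_trans (ler_norm _); rewrite mulrDr mulr_natl mulr2n lerD.
  have n0 : 0 < n.+1%:R :> R by [].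
  rewrite -(ler_pM2r (_ : 0 < 2 * n.+1%:R^-1)) ?mulr_gt0 ?invr_gt0 //.
  apply: le_trans (ler_wpM2l (normr_ge0 _) lb) _.
  rewrite -normrM -subr_sqr (le_trans abs2) // natrM.
  by rewrite le_eqVlt; apply/orP; left; apply/eqP; field.
rewrite !mxE; apply: le_trans (lerD head tail) _.
by rewrite -mulrDl -natrD -mulnSr.
Qed.

(** A grid of mesh 1 / M in the coordinates other than [j] cuts the set into at most (3 M)^n times
    the product of the [r k] cells, each of diameter at most D / M; the powers of M cancel. *)
Lemma hausdorff_cap_box s j (r : 'I_n -> R) : (forall k, 0 < r k) ->
  (hausdorff n [set v | cap s j v /\ forall k, (`|v 0 (lift j k)| <= r k)%R]
    <= (ball_volume R n * (3 * (n * n.+2)%:R) ^+ n * \prod_k r k)%:E)%E.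
Proof.
move=> r0; apply: ge_ereal_sup => _ [d /= d0 <-].
pose D : R := (n * n.+2)%:R.
(* The second condition makes the cells admissible at scale [d]; the third absorbs the extra cell in
   each direction, as 2 r M + 1 is then at most 3 r M. *)
have [M [M0 MD Mr]] : exists M : nat,
    [/\ 0 < M%:R :> R, D / M%:R <= d & forall k, 1 <= r k * M%:R].
  pose x := D / d + \sum_k (r k)^-1 + 1.
  have x1 : 1 <= x.
    by rewrite lerDr addr_ge0 ?divr_ge0 ?(ltW d0) // sumr_ge0 // => k _; rewrite invr_ge0 ltW.
  have x0 : 0 < x by apply: lt_le_trans x1.
  have xM := ltW (truncnS_gt x).
  exists (Num.truncn x).+1; split => // [|k].
    rewrite ler_pdivrMr // mulrC -ler_pdivrMr // (le_trans _ xM) // /x -addrA lerDl.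
    by rewrite addr_ge0 // sumr_ge0 // => k _; rewrite invr_ge0 ltW.
  rewrite mulrC -ler_pdivrMr // div1r (le_trans _ xM) // /x (bigD1 k) //=.
  rewrite addrAC addrCA lerDl !addr_ge0 ?divr_ge0 ?(ltW d0) //.
  by rewrite sumr_ge0 // => i _; rewrite invr_ge0 ltW.
pose L k := (Num.truncn (2 * r k * M%:R)).+1.
pose cell (g : {dffun forall k : 'I_n, 'I_(L k)}) := [set v | [/\ cap s j v,
  forall k, `|v 0 (lift j k)| <= r k &
  forall k, Num.truncn ((v 0 (lift j k) + r k) * M%:R) = g k]].
apply: le_trans (@hausdorff_content_fincover _ _ n d _ _ cell _ _) _.
- move=> v [vc vr].
  have gP (k : 'I_n) : (Num.truncn ((v 0 (lift j k) + r k) * M%:R)%R < L k)%N.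
    rewrite ltnS; apply: le_truncn; rewrite ler_wpM2r ?(ltW M0) //.
    by have := vr k; rewrite ler_norml => /andP[? ?]; lra.
  exists [ffun k => Ordinal (gP k)] => //; split => // k.
  by rewrite ffunE.
- move=> g; apply: diam_le => v w [vc vr vg] [wc wr wg].
  apply: le_trans MD; apply: cap_enormB vc wc _ => k.
  rewrite -[X in _ <= X]mul1r ler_pdivlMr // -[M%:R]ger0_norm ?(ltW M0) // -normrM.
  have -> : (v 0 (lift j k) - w 0 (lift j k)) * M%:R =
    (v 0 (lift j k) + r k) * M%:R - (w 0 (lift j k) + r k) * M%:R by ring.
  apply: truncn_eq_dist; last by rewrite vg wg.
    by rewrite mulr_ge0 ?(ltW M0) //; have := vr k; rewrite ler_norml => /andP[? ?]; lra.
  by rewrite mulr_ge0 ?(ltW M0) //; have := wr k; rewrite ler_norml => /andP[? ?]; lra.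
apply: (@le_trans _ _ (\sum_(g : {dffun forall k : 'I_n, 'I_(L k)})
    (ball_volume R n * (2^-1 * (D / M%:R)) ^+ n)%:E)%E).
  apply: lee_sum => g _; apply: hausdorff_gauge_le.
    by rewrite divr_ge0 ?(ltW M0) // /D ler0n.
  apply: diam_le => v w [vc vr vg] [wc wr wg].
  apply: cap_enormB vc wc _ => k.
  rewrite -[X in _ <= X]mul1r ler_pdivlMr // -[M%:R]ger0_norm ?(ltW M0) // -normrM.
  have -> : (v 0 (lift j k) - w 0 (lift j k)) * M%:R =
    (v 0 (lift j k) + r k) * M%:R - (w 0 (lift j k) + r k) * M%:R by ring.
  apply: truncn_eq_dist; last by rewrite vg wg.
    by rewrite mulr_ge0 ?(ltW M0) //; have := vr k; rewrite ler_norml => /andP[? ?]; lra.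
  by rewrite mulr_ge0 ?(ltW M0) //; have := wr k; rewrite ler_norml => /andP[? ?]; lra.
rewrite sumEFin lee_fin sumr_const card_dep_ffun.
have -> : foldr muln 1 [seq #|{: 'I_(L k)}| | k : 'I_n] = (\prod_k L k)%N.
  rewrite foldrE big_map big_enum /=; apply: eq_bigr => k _; exact: card_ord.
rewrite -[leLHS]mulr_natl natr_prod.
have step : \prod_k (L k)%:R <= (3 * M%:R) ^+ n * \prod_k r k.
  rewrite -[n in _ ^+ n]card_ord -prodr_const -big_split /=.
  apply: ler_prod => k _; rewrite ler0n /= /L -natr1.
  have := @truncn_itv _ (2 * r k * M%:R); have := Mr k.
  have : 0 <= 2 * r k * M%:R by rewrite !mulr_ge0 ?ltW.
  by move=> /[swap] h1 /[swap] /[apply] /andP[h2 _]; lra.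
have c0 : 0 <= ball_volume R n * (2^-1 * (D / M%:R)) ^+ n.
  apply: mulr_ge0; first exact/ltW/ball_volume_gt0.
  by rewrite exprn_ge0 // mulr_ge0 ?invr_ge0 // divr_ge0 ?(ltW M0) // /D ler0n.
apply: le_trans (ler_wpM2r c0 step) _.
rewrite mulrCA -!mulrA ler_wpM2l ?(ltW (ball_volume_gt0 _)) // mulrA mulrAC -exprMn.
rewrite ler_wpM2r ?prodr_ge0 // => [k _|]; first exact: ltW.
apply: lerXn2r; rewrite ?nnegrE; last 1 first.
- rewrite -/D [leLHS](_ : _ = 3 * D * 2^-1); last by field; rewrite gt_eqF.
  by rewrite ler_piMr ?mulr_ge0 ?/D ?ler0n // invf_le1 // ler1n.
- by rewrite !mulr_ge0 ?invr_ge0 ?ler0n ?ltW.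
- by rewrite mulr_ge0 ?ler0n.
Qed.

(** On a cap whose solved coordinate is not [l], the strip is a box with one side [e] and all others
    1. *)
Lemma hausdorff_coord_strip (l : 'I_n.+1) : exists C : R, 0 <= C /\
  forall e : R, 0 < e ->
    (hausdorff n (S `&` [set v | (`|v 0 l| <= e)%R]) <= (C * e)%:E)%E.
Proof.
pose K : R := ball_volume R n * (3 * (n * n.+2)%:R) ^+ n.
have K0 : 0 <= K by rewrite mulr_ge0 ?exprn_ge0 ?mulr_ge0 ?ler0n // ltW ?ball_volume_gt0.
pose C : R := n.+1%:R * K.
have C0 : 0 <= C by rewrite mulr_ge0 ?ler0n.
exists ((2 * n.+1)%:R * C); split=> [|e e0]; first by rewrite mulr_ge0 ?ler0n.
pose F (sj : bool * 'I_n.+1) := cap sj.1 sj.2 `&` [set v | (`|v 0 l| <= e)%R].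
apply: le_trans (@outer_measure_fincover _ _ (@hausdorff R n.+1 n) _ _ F _) _.
  by move=> v [/[dup] vS /sphere_cap[s [j sjv]] vl]; exists (s, j).
have -> : ((2 * n.+1)%:R * C * e)%:E = (\sum_(sj : bool * 'I_n.+1) (C * e)%:E)%E.
  by rewrite sumEFin sumr_const card_prod card_bool card_ord -(mulr_natl (C * e)) mulrA.
apply: lee_sum => -[s j] _; rewrite /F /=.
have KC : K <= C by rewrite /C ler_peMl // ler1n.
have bound (r : 'I_n -> R) : (forall k, 0 < r k) ->
    (forall v, cap s j v -> `|v 0 l| <= e -> forall k, `|v 0 (lift j k)| <= r k) ->
    \prod_k r k * K <= C * e ->
    (hausdorff n (cap s j `&` [set v | (`|v 0 l| <= e)%R]) <= (C * e)%:E)%E.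
  move=> r0 vr rC; apply: le_trans (_ : _ <= _)%E (le_trans (hausdorff_cap_box s j r0) _).
    by apply: le_hausdorff => v [vc vl]; split => // k; exact: vr.
  by rewrite lee_fin -/K mulrC.
have cap1 v k : cap s j v -> `|v 0 (lift j k)| <= 1.
  by move=> [vS _]; exact: coord_unit_sphere.
(* If [l] is the solved coordinate, a strip thinner than the cap threshold misses the cap; for a
   thicker one the factor [n.+1] in [C] makes the bound for the whole cap sufficient. *)
have [jl|jl] := eqVneq j l.
  have [en|en] := ltP e n.+1%:R^-1.
    rewrite (_ : _ `&` _ = set0) ?hausdorff_set0 ?lee_fin ?(mulr_ge0 C0 (ltW e0)) //.
    apply/seteqP; split => // v [[_ vj] /= vl]; exfalso.
    have := le_trans vj (ler_norm _); rewrite normrM normrX normrN1 expr1n mul1r jl.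
    by move/le_trans => /(_ _ vl); rewrite leNgt en.
  apply: (bound (fun=> 1)) => //; first by move=> v vc _ k; exact: cap1.
  rewrite big1 // mul1r /C mulrAC ler_peMl // mulrC -ler_pdivrMr ?ltr0n //.
  by rewrite div1r.
have [e1|e1] := ltP 1 e.
  apply: (bound (fun=> 1)) => //; first by move=> v vc _ k; exact: cap1.
  by rewrite big1 // mul1r (le_trans KC) // ler_peMr // ltW.
have [k jk _] := unlift_some jl.
apply: (bound (fun i => if i == k then e else 1)) => [i|v vc vl i|].
- by case: ifP.
- by case: eqP => [->|_]; [rewrite -jk|exact: cap1].
- rewrite (bigD1 k) //= eqxx big1 ?mulr1; last by move=> i /negbTE->.
  by rewrite mulrC ler_wpM2r ?(ltW e0).
Qed.

Lemma hausdorff_unit_sphere_fin : (hausdorff n S < +oo)%E.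
Proof.
have [C [_ /(_ 1 ltr01) h]] := hausdorff_coord_strip ord0.
apply: le_lt_trans (le_trans _ h) (ltry _).
by apply: le_hausdorff => v vS; split => //; exact: coord_unit_sphere.
Qed.

Definition reflection (c x : 'rV[R]_n.+1) := x - (2 * dot x c / dot c c) *: c.

Lemma dot_reflection c x y : dot (reflection c x) y = dot x (reflection c y).
Proof. rewrite /reflection dotBl dotBr dotZl dotZr (dotC c y); ring. Qed.

Lemma reflectionK c : involutive (reflection c).
Proof.
move=> x; have [->|c0] := eqVneq c 0; first by rewrite /reflection !scaler0 !subr0.
have cc : dot c c != 0 by rewrite dot_eq0.
have h : dot (reflection c x) c = - dot x c by rewrite dotBl dotZl; field.
by rewrite {1}/reflection h mulrN mulNr scaleNr opprK subrK.
Qed.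

Lemma enorm_reflection c x : enorm (reflection c x) = enorm x.
Proof. by rewrite /enorm dot_reflection reflectionK. Qed.

Lemma reflectionB c x y : reflection c x - reflection c y = reflection c (x - y).
Proof.
rewrite /reflection dotBl mulrBr mulrBl scalerBl !opprB.
by rewrite addrACA [RHS]addrACA; congr (_ + _); exact: addrC.
Qed.

Lemma reflection_swap c d : dot c c = dot d d -> reflection (c - d) c = d.
Proof.
move=> cd; have [->|cd0] := eqVneq c d.
  by rewrite /reflection subrr scaler0 subr0.
have e : 2 * dot c (c - d) = dot (c - d) (c - d).
  by rewrite dotBr dotBl !dotBr (dotC d c) -cd; ring.
rewrite /reflection e mulfV ?dot_eq0 ?subr_eq0 //.
by rewrite scale1r opprB addrC subrK.
Qed.

(** A reflection exchanging the direction of [c] with the first basis vector is an isometry and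
    reduces this to a coordinate strip. *)
Lemma hausdorff_strip (c : 'rV[R]_n.+1) : c != 0 -> exists C : R, 0 <= C /\
  forall e : R, 0 < e ->
    (hausdorff n (S `&` [set v | (`|dot v c| <= e)%R]) <= (C * e)%:E)%E.
Proof.
move=> c0; have c_gt0 : 0 < enorm c by rewrite enorm_gt0.
have [C [C0 hC]] := hausdorff_coord_strip ord0.
exists (C / enorm c); split=> [|e e0]; first by rewrite divr_ge0 // ltW.
rewrite mulrAC -mulrA; apply: le_trans (hC _ (divr_gt0 e0 c_gt0)).
pose d : 'rV[R]_n.+1 := delta_mx 0 0.
pose u := (enorm c)^-1 *: c; pose f := reflection (u - d).
have uu : dot u u = dot d d.
  rewrite dot_delta mxE !eqxx /= /u dotZl dotZr -sqr_enorm.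
  by field; rewrite gt_eqF.
apply: (@hausdorff_image_le _ _ n _ _ f) => [x y|v [vS vc]].
  by rewrite reflectionB enorm_reflection.
exists (f v); last exact: reflectionK.
split; first by rewrite /= /unit_sphere /= enorm_reflection.
have fd : f d = u by apply: (canLR (reflectionK _)); rewrite (reflection_swap uu).
rewrite /= -dot_delta -/d dot_reflection -/(f d) fd /u dotZr.
by rewrite normrM ger0_norm ?invr_ge0 ?enorm_ge0 // mulrC ler_pM2r ?invr_gt0.
Qed.

Lemma hausdorff_subsphere (c : 'rV[R]_n.+1) : c != 0 ->
  hausdorff n (S `&` [set v | dot v c = 0]) = 0%E.
Proof.
move=> /hausdorff_strip[C [C0 hC]]; apply/eqP; rewrite eq_le hausdorff_ge0 andbT.
apply/lee_addgt0Pr => e e0; rewrite add0e.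
have C1 : 0 < C + 1 by rewrite ltr_wpDl.
apply: le_trans (le_trans (hC (e / (C + 1)) _) _).
- by apply: le_hausdorff => v [vS /= vc]; split => //=; rewrite vc normr0 divr_ge0 ?ltW.
- by rewrite divr_gt0.
- by rewrite lee_fin mulrCA ler_piMr ?ltW // ltr_pdivrMr // mul1r ltrDl.
Qed.

End SphereCover.

(** * Volume of a box covered by countably many boxes *)

Section Covering.
Context {R : realType}.
Implicit Types (a b : nat -> nat -> R) (c lo hi x : nat -> R) (V : R).

Local Notation box a b n i x := (\prod_(k < n) ((a i k <= x k <= b i k)%R%:R : R)).

(* Integrating the hypothesis over the last coordinate gives the statement in
   one dimension less. *)
Lemma box_cover_volume (n : nat) lo hi a b c V :
  (forall k, lo k <= hi k) -> (forall i k, a i k <= b i k) ->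
  (forall i, 0 <= c i) -> 0 <= V ->
  (forall x, (forall k, (k < n)%N -> lo k <= x k <= hi k) ->
    (V%:E <= \sum_(i <oo) (c i * box a b n i x)%:E)%E) ->
  ((V * \prod_(k < n) (hi k - lo k))%:E
     <= \sum_(i <oo) (c i * \prod_(k < n) (b i k - a i k))%:E)%E.
Proof.
move=> lohi ab; elim: n c V => [|n IH] c V c0 V0 cover.
  rewrite big_ord0 mulr1; apply: le_trans (cover lo _) _ => //.
  by apply: lee_nneseries => i; rewrite !big_ord0 mulr1 // lee_fin.
rewrite big_ord_recr /= [_ * (hi n - lo n)]mulrC mulrA.
under eq_eseriesr do rewrite big_ord_recr /= [_ * (b _ n - _)]mulrC mulrA.
(* The weights [c i] and the constant [V] absorb the side lengths in the last coordinate. *)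
apply: IH => [i||x xlohi]; try by rewrite mulr_ge0 ?subr_ge0.
pose D : set R := `[lo n, hi n]%classic.
have mD : measurable D by exact: measurable_itv.
have muD (l h : R) : l <= h -> lebesgue_measure `[l, h]%classic = (h - l)%:E.
  rewrite le_eqVlt => /predU1P[->|lh]; first by rewrite set_itv1 lebesgue_measure_set1 subrr.
  by rewrite lebesgue_measure_itv /= lte_fin lh EFinB.
pose g i (t : R) := ((c i * box a b n i x)%:E * (\1_(`[a i n, b i n]%classic) t)%:E)%E.
have w0 i : 0 <= c i * box a b n i x by rewrite mulr_ge0 // prodr_ge0.
have g0 i t : D t -> (0 <= g i t)%E by move=> _; rewrite mule_ge0 // lee_fin.
have mg i : measurable_fun D (g i).
  by apply: measurable_funeM; apply/measurable_EFinP; exact: measurable_indic.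
have -> : ((V * (hi n - lo n))%:E = \int[lebesgue_measure]_(t in D) V%:E)%E.
  by rewrite integral_cst // EFinM; congr (_ * _)%E; exact/esym/muD.
apply: (@le_trans _ _ (\int[lebesgue_measure]_(t in D) \sum_(i <oo) g i t)%E).
  apply: ge0_le_integral => //.
    by apply: ge0_emeasurable_sum => [i t Dt _|i _]; [exact: g0|exact: mg].
  move=> t Dt; pose y (k : nat) : R := if k == n then (t : R) else x k.
  apply: le_trans (cover y _) _.
    move=> k; rewrite ltnS leq_eqVlt /y; case: eqP => [-> _|_ /=]; last exact: xlohi.
    by move: Dt; rewrite /D /= in_itv.
  apply: lee_nneseries => i.
    by move=> _ _; rewrite lee_fin mulr_ge0 // prodr_ge0.
  move=> _; rewrite /g big_ord_recr /= mulrA -EFinM lee_fin /y eqxx indicE.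
  rewrite mem_setE /= in_itv /= (eq_bigr (fun k : 'I_n => (a i k <= x k <= b i k)%R%:R)) //.
  by move=> k _; rewrite ltn_eqF.
rewrite integral_nneseries //.
apply: lee_nneseries => i.
  by move=> _ _; apply: integral_ge0 => t Dt; exact: g0.
move=> _; rewrite ge0_integralZl_EFin //; last first.
  by apply/measurable_EFinP; exact: measurable_indic.
rewrite [X in (_ <= X%:E)%E]mulrAC [X in (_ <= X)%E]EFinM.
apply: lee_wpmul2l; rewrite ?lee_fin //.
rewrite integral_indic // -muD //; apply: le_measure => //; rewrite ?inE //.
exact: measurableI.
Qed.
End Covering.

Lemma nneseries_ge_term (R : realType) (f : nat -> \bar R) (i : nat) :
  (forall k, 0 <= f k)%E -> (f i <= \sum_(k <oo) f k)%E.
Proof.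
move=> f0; apply: le_trans (nneseries_lim_ge i.+1 _) => //.
by rewrite big_nat_recr //= leeDr // sume_ge0.
Qed.

(** * Lower bound: balls on the sphere have positive measure *)

Section Positivity.
Context {R : realType} {n : nat}.
Local Notation S := (unit_sphere (R := R) (n := n)).

(** Near [u] the sphere is a graph over the coordinates other than [j]: the missing one is solved
    from the sphere equation, with the sign of [u 0 j]. *)
Lemma sphere_graph (u : 'rV[R]_n.+1) (j : 'I_n.+1) (e : R) :
  S u -> u 0 j != 0 -> 0 < e ->
  exists2 r : R, 0 < r & forall z : 'I_n -> R,
    (forall k, `|z k - u 0 (lift j k)| <= r) ->
    exists v, [/\ S v, enorm (v - u) < e & forall k, v 0 (lift j k) = z k].
Proof.
move=> uS uj0 e0; have uj_gt0 : 0 < `|u 0 j| by rewrite normr_gt0.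
have u2_gt0 : 0 < u 0 j ^+ 2 by rewrite exprn_even_gt0.
pose N : R := n.+1%:R; have N0 : 0 < N by [].
have n_le : n%:R <= N by rewrite ler_nat.
pose D := N + 3 * N / `|u 0 j|; have D0 : 0 < D by rewrite addr_gt0 // divr_gt0 // mulr_gt0.
(* The second bound keeps one minus the sum of the squares of [z] nonnegative. The third makes the
   point [e]-close to [u]: [D] adds up the errors of the given coordinates and of the solved one. *)
pose r := Num.min 1 (Num.min (u 0 j ^+ 2 / (3 * N)) (e / (2 * D))).
have r0 : 0 < r by rewrite !lt_min ltr01 !divr_gt0 // mulr_gt0.
have r1 : r <= 1 by rewrite ge_min lexx.
have r2 : 3 * N * r <= u 0 j ^+ 2.
  by rewrite mulrC -ler_pdivlMr ?mulr_gt0 // !ge_min lexx !orbT.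
have r3 : D * r < e.
  have : r <= e / (2 * D) by rewrite !ge_min lexx !orbT.
  rewrite ler_pdivlMr ?mulr_gt0 // => h; have := mulr_gt0 r0 D0; lra.
exists r => // z zr.
have uu := unit_sphere_dot uS.
pose c k := u 0 (lift j k).
have zc : `|\sum_k (c k * c k) - \sum_k (z k * z k)| <= 3 * N * r.
  rewrite -sumrB; apply: le_trans (ler_norm_sum _ _ _) _.
  apply: (@le_trans _ _ (\sum_(k < n) (3 * r))).
    apply: ler_sum => k _; rewrite -!expr2 subr_sqr normrM mulrC ler_pM //; last by rewrite distrC.
    have c1 : `|c k| <= 1 by exact: coord_unit_sphere.
    have -> : c k + z k = c k + c k + (z k - c k) by ring.
    apply: le_trans (ler_normD _ _) _; apply: le_trans (lerD (ler_normD _ _) (zr k)) _.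
    by rewrite (_ : 3 = 1 + 1 + 1) ?lerD //; ring.
  rewrite sumr_const card_ord -(mulr_natl (3 * r)) [leRHS]mulrAC [leLHS]mulrC.
  by rewrite ler_wpM2l // mulr_ge0 // ltW.
move: uu; rewrite /dot (bigD1_ord j) //= -/(c _) -expr2 => uu.
pose t := 1 - \sum_k (z k * z k).
have t0 : 0 <= t by have := le_trans zc r2; rewrite ler_norml => /andP[? ?]; rewrite /t; lra.
pose vj := Num.sg (u 0 j) * Num.sqrt t.
have vj2 : vj * vj = t.
  rewrite -expr2 exprMn sqr_sqrtr // -[RHS]mul1r; congr (_ * _).
  by rewrite sqr_sg uj0.
pose v : 'rV[R]_n.+1 := \row_i (if unlift j i is Some k then z k else vj).
have vlift k : v 0 (lift j k) = z k by rewrite mxE liftK.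
have vjE : v 0 j = vj by rewrite mxE unlift_none.
have vS : S v.
  rewrite /unit_sphere /= /enorm /dot (bigD1_ord j) //= vjE vj2.
  under eq_bigr do rewrite vlift.
  by rewrite /t subrK sqrtr1.
exists v; split => //; apply: le_lt_trans (enorm_le_sum _) _.
rewrite (bigD1_ord j) //= !mxE unlift_none.
have tail : \sum_(k < n) `|(v - u) 0 (lift j k)| <= N * r.
  apply: (@le_trans _ _ (\sum_(k < n) r)).
    by apply: ler_sum => k _; rewrite mxE vlift mxE.
  by rewrite sumr_const card_ord -(mulr_natl r) ler_wpM2r // ltW.
have head : `|vj - u 0 j| <= 3 * N / `|u 0 j| * r.
  rewrite mulrAC ler_pdivlMr //.
  apply: (@le_trans _ _ (`|vj - u 0 j| * `|vj + u 0 j|)).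
    rewrite ler_wpM2l // {2}[u 0 j]numEsg -mulrDr normrM normr_sg uj0 mul1r.
    by rewrite ger0_norm ?addr_ge0 ?sqrtr_ge0 // lerDr sqrtr_ge0.
  rewrite -normrM -subr_sqr [vj ^+ 2]expr2 vj2 /t.
  by rewrite (_ : _ - _ = \sum_k (c k * c k) - \sum_k (z k * z k)) //; lra.
by apply: le_lt_trans r3; rewrite /D mulrDl addrC; exact: lerD.
Qed.

(** Dropping the coordinate [j] turns a cover of the ball into a cover of a cube of side 2 r by
    cubes centred at points of the pieces, so [box_cover_volume] bounds the sum of the gauges
    below. *)
Lemma hausdorff_sphere_ball_gt0 (u : 'rV[R]_n.+1) (e : R) : S u -> 0 < e ->
  (0 < hausdorff n (S `&` [set v | (enorm (v - u) < e)%R]))%E.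
Proof.
move=> uS e0.
have [j uj0] : exists j, u 0 j != 0.
  apply: contrapT => /forallNP u0; have := unit_sphere_dot uS.
  rewrite (_ : u = 0) ?dot0l; first by move/eqP; rewrite eq_sym oner_eq0.
  by apply/rowP => i; rewrite mxE; apply/eqP; have /negP := u0 i; rewrite negbK.
have [r r0 graph] := sphere_graph uS uj0 e0.
(* A piece of diameter d lies over a cube of side 2 d, and its gauge is [kap] times the volume of
   that cube. *)
pose kap : R := ball_volume R n * (4^-1) ^+ n.
have kap0 : 0 < kap by rewrite mulr_gt0 ?ball_volume_gt0 // exprn_gt0.
pose crd (y : 'rV[R]_n.+1) (k : nat) : R :=
  if insub k is Some k' then y 0 (lift j (k' : 'I_n)) else 0.
have crdE y (k : 'I_n) : crd y k = y 0 (lift j k) by rewrite /crd valK.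
apply: (@lt_le_trans _ _ (kap * (2 * r) ^+ n)%:E).
  by rewrite lte_fin mulr_gt0 // exprn_gt0 // mulr_gt0.
apply: le_trans (@hausdorff_content_le_hausdorff _ _ n 1 _ ltr01).
apply: le_ereal_inf_tmp => _ [F [AF dF] <-].
pose y i : 'rV[R]_n.+1 := xget 0 (F i).
pose d i : R := fine (diam (F i)).
(* Empty pieces get weight 0: their gauge is 0 even for [n = 0], where the empty product of side
   lengths is 1. *)
pose c i : R := if F i == set0 then 0 else 1.
have c0 i : 0 <= c i by rewrite /c; case: ifP.
have dE i : F i != set0 -> diam (F i) = (d i)%:E /\ 0 <= d i.
  move=> /set0P Fi0; have := diam_ge0 Fi0; have := dF i; rewrite /d.
  by case: (diam (F i)) => //= s _; rewrite lee_fin.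
have yF i : F i != set0 -> F i (y i).
  by move=> /set0P; exact: xgetPex.
pose dp i := if F i == set0 then 0 else d i.
have dp0 i : 0 <= dp i by rewrite /dp; case: ifPn => // /dE[].
have vol : ((1 * \prod_(k < n) (crd u k + r - (crd u k - r)))%:E <=
    \sum_(i <oo) (c i * \prod_(k < n)
      (crd (y i) k + dp i - (crd (y i) k - dp i)))%:E)%E.
  apply: (@box_cover_volume R n (fun k => crd u k - r) (fun k => crd u k + r)
    (fun i k => crd (y i) k - dp i) (fun i k => crd (y i) k + dp i) c 1) => //.
  + by move=> k; have := r0; lra.
  + by move=> i k; have := dp0 i; lra.
  + move=> x xr; have [|v [vS vu vx]] := graph (fun k => x k).
    move=> k; have := xr k (ltn_ord k); rewrite crdE => /andP[? ?].
    by rewrite ler_norml; apply/andP; split; lra.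
  have [i _ Fiv] := AF v (conj vS vu).
  have Fi0 : F i != set0 by apply/set0P; exists v.
  have w0 i' : (0 <= (c i' * \prod_(k < n) (crd (y i') k - dp i' <= x k <= crd (y i') k + dp i')%R%:R)%:E)%E.
    by rewrite lee_fin mulr_ge0 // prodr_ge0.
  apply: le_trans (nneseries_ge_term i w0).
  rewrite lee_fin /c (negbTE Fi0) mul1r big1 // => k _.
  rewrite crdE -vx /dp (negbTE Fi0).
  have [dFi _] := dE i Fi0.
  have : ((enorm (v - y i))%:E <= (d i)%:E)%E by rewrite -dFi; apply: le_diam (yF _ Fi0).
  rewrite lee_fin => /(le_trans (coord_le_enorm _ (lift j k))).
  rewrite !mxE ler_norml => /andP[? ?].
  by have -> : (y i 0 (lift j k) - d i <= v 0 (lift j k) <= y i 0 (lift j k) + d i)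
    by apply/andP; split; lra.
rewrite mul1r in vol.
have -> : (2 * r) ^+ n = \prod_(k < n) (crd u k + r - (crd u k - r)).
  by rewrite -[n in LHS]card_ord -prodr_const; apply: eq_bigr => k _; lra.
rewrite EFinM; apply: le_trans (lee_wpmul2l _ vol) _; first by rewrite lee_fin ltW.
rewrite -nneseriesZl; last first.
  move=> i _; rewrite lee_fin mulr_ge0 // prodr_ge0 // => k _.
  by have := dp0 i; lra.
apply: lee_nneseries => i.
  move=> _ _; rewrite -EFinM lee_fin mulr_ge0 ?(ltW kap0) // mulr_ge0 //.
  by rewrite prodr_ge0 // => k _; have := dp0 i; lra.
move=> _; rewrite /c; have [->|Fi0] := eqVneq (F i) set0.
  by rewrite mul0r mule0 hausdorff_gauge_ge0.
have [dFi di0] := dE i Fi0.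
rewrite mul1r /hausdorff_gauge (negbTE Fi0) dFi -!EFinM -EFin_expe -EFinM lee_fin.
rewrite /kap -mulrA ler_wpM2l ?(ltW (ball_volume_gt0 _)) //.
rewrite -[n in _ ^+ n * _]card_ord -prodr_const -big_split /=.
rewrite -[n in leRHS]card_ord -prodr_const le_eqVlt; apply/orP; left; apply/eqP.
by apply: eq_bigr => k _; rewrite /dp (negbTE Fi0); field.
Qed.

End Positivity.

(** * Normal cones and the variational problem *)

Lemma outer_measure_null_setD (R : realType) (T : Type)
    (mu : {outer_measure set T -> \bar R}) (A B : set T) :
  mu (B `&` A) = 0%E -> mu (B `\` A) = mu B.
Proof.
move=> BA0; apply/eqP; rewrite eq_le; apply/andP; split.
  by apply: le_outer_measure; exact: subDsetl.
by apply: le_trans (le_outer_measureIC mu A B) _; rewrite BA0 add0e setDE.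
Qed.

(** The union is split by the Caratheodory condition for its first set, which meets the union of the
    others in a null set by subadditivity. *)
Lemma outer_measure_bigsetU_null (R : realType) (T : Type)
    (mu : {outer_measure set T -> \bar R}) (I : eqType) (s : seq I)
    (A : I -> set T) :
  uniq s -> (forall a, mu.-caratheodory (A a)) ->
  (forall a b, a != b -> mu (A a `&` A b) = 0%E) ->
  mu (\big[setU/set0]_(a <- s) A a) = (\sum_(a <- s) mu (A a))%E.
Proof.
move=> + mA A0; elim: s => [|a s IH] /=; first by rewrite !big_nil outer_measure0.
move=> /andP[as_ us]; rewrite !big_cons -IH //.
set B := \big[setU/set0]_(j <- s) A j.
rewrite (mA a (A a `|` B)) setUK setIUl setICr set0U -setDE.
congr (_ + _)%E; apply: outer_measure_null_setD.
apply/eqP; rewrite eq_le outer_measure_ge0 andbT.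
apply: (@le_trans _ _ (\sum_(b <- s) mu (A b `&` A a))%E); last first.
  rewrite big_seq big1 // => b bs; apply: A0.
  by apply: contra as_ => /eqP <-.
rewrite {}/B; elim: s {IH as_ us} => [|b s IH].
  by rewrite !big_nil set0I outer_measure0.
rewrite !big_cons setIUl.
exact: le_trans (outer_measureU2 _ _ _) (leeD _ IH).
Qed.

(** Intersecting with the sphere gives a finite outer measure on the ambient space, in which
    half-spaces and cones can be measured directly. *)
Definition sphere_measure (R : realType) (n : nat) (X : set 'rV[R]_n.+1) : \bar R :=
  hausdorff n (X `&` unit_sphere (n := n)).

Section SphereMeasure.
Context {R : realType} {n : nat}.
Local Notation S := (unit_sphere (R := R) (n := n)).
Local Notation sigma := (@sphere_measure R n).

Lemma sphere_measure_set0 : sigma set0 = 0%E.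
Proof. by rewrite /sphere_measure set0I hausdorff_set0. Qed.

Lemma sphere_measure_ge0 X : (0 <= sigma X)%E.
Proof. exact: hausdorff_ge0. Qed.

Lemma le_sphere_measure : {homo sigma : A B / A `<=` B >-> (A <= B)%E}.
Proof. by move=> A B AB; apply: le_hausdorff; exact: setSI. Qed.

Lemma sphere_measure_sigma_subadditive : sigma_subadditive sigma.
Proof.
by move=> F; rewrite /sphere_measure setI_bigcupl; exact: hausdorff_sigma_subadditive.
Qed.

HB.instance Definition _ := isOuterMeasure.Build R 'rV[R]_n.+1 sigma
  sphere_measure_set0 sphere_measure_ge0 le_sphere_measure
  sphere_measure_sigma_subadditive.

Lemma sphere_measure_lty X : (sigma X < +oo)%E.
Proof.
by apply: le_lt_trans hausdorff_unit_sphere_fin; apply: le_hausdorff => x [].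
Qed.

Lemma sphere_measure_fin X : sigma X \is a fin_num.
Proof. by rewrite ge0_fin_numE ?sphere_measure_ge0 // sphere_measure_lty. Qed.

Lemma sphere_measureT_gt0 : (0 < sigma setT)%E.
Proof.
have /set_mem dS := delta_in_sphere R n.
apply: lt_le_trans (hausdorff_sphere_ball_gt0 dS ltr01) _.
by rewrite /sphere_measure setTI; apply: le_hausdorff => v [].
Qed.

Lemma sphere_measureN X : sigma [set - x | x in X] = sigma X.
Proof.
have le Y Z : Z `<=` [set - x | x in Y] -> (sigma Z <= sigma Y)%E.
  move=> ZY; apply: (@hausdorff_image_le _ _ n _ _ -%R) => [x y|x [/ZY[y Yy <-] yS]].
    by rewrite -opprD enormN.
  by exists y => //; split => //; rewrite /= /unit_sphere /= -enormN.
apply/eqP; rewrite eq_le !le //.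
by move=> x Xx; exists (- x); [exists x|rewrite opprK].
Qed.

(* Removing a thin strip, of small measure, along the boundary hyperplane puts
   the two parts of a set at a positive distance, where outer Hausdorff measures
   are additive. *)
Lemma halfspace_caratheodory (c : 'rV[R]_n.+1) :
  (sigma).-caratheodory [set v | dot v c <= 0].
Proof.
have [->|c0] := eqVneq c 0.
  rewrite (_ : [set _ | _] = setT); last by apply/seteqP; split => // v _ /=; rewrite dotC dot0l.
  by move=> X; rewrite setIT setCT setI0 outer_measure0 adde0.
have [C [C0 strip]] := hausdorff_strip c0.
apply: le_caratheodory_measurable => X; apply/lee_addgt0Pr => e e0.
set A := [set v | dot v c <= 0].
have C1 : 0 < C + 1 by rewrite ltr_wpDl.
pose d := e / (C + 1); have d0 : 0 < d by rewrite divr_gt0.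
pose B := [set v | d < dot v c].
apply: (@le_trans _ _ (sigma (X `&` A) + sigma (X `&` B) + e%:E)%E).
  rewrite -addeA leeD2l //.
  apply: (@le_trans _ _ (sigma ((X `&` B) `|` [set v | `|dot v c| <= d]))).
    apply: le_sphere_measure => v [Xv /negP v0]; rewrite -ltNge in v0.
    have [vd|dv] := leP (dot v c) d; last by left.
    by right; rewrite /= ger0_norm // ltW.
  apply: le_trans (outer_measureU2 _ _ _) _; rewrite leeD2l //.
  rewrite /= /sphere_measure setIC; apply: le_trans (strip d d0) _.
  by rewrite lee_fin mulrCA ler_piMr ?(ltW e0) // ler_pdivrMr // mul1r lerDl.
rewrite leeD2r //.
have c_gt0 : 0 < enorm c by rewrite enorm_gt0.
apply: le_trans (@hausdorffD_separated _ _ n (d / (2 * enorm c)) _ _ _ _ _ _) _.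
- by rewrite divr_gt0 // mulr_gt0.
- exact: sphere_measure_lty.
- exact: sphere_measure_lty.
- move=> x y [[_ xA] _] [[_ yB] _]; rewrite ltr_pdivrMr ?mulr_gt0 //.
  have := dot_le_enorm (y - x) c; rewrite dotBl enormBC.
  by rewrite /A /B /= in xA yB; lra.
- by apply: le_hausdorff => v [] [[Xv _] vS].
Qed.

(** According to the sign of [dot v b], the set is a union of two intersections of half-spaces. *)
Lemma abs_dot_le_caratheodory (a b : 'rV[R]_n.+1) :
  (sigma).-caratheodory [set v | `|dot v a| <= `|dot v b|].
Proof.
pose H (c : 'rV[R]_n.+1) := [set v | dot v c <= 0].
have -> : [set v | `|dot v a| <= `|dot v b|] =
    (H (a - b) `&` H (- (a + b))) `|` (H (b - a) `&` H (a + b)).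
  apply/seteqP; split => v; rewrite /H /= !(dotBr, dotNr, dotDr).
    by rewrite ler_norml; have [?|?] := ler0P (dot v b) => /andP[? ?];
      [right|left]; split; lra.
  by case=> -[h1 h2]; rewrite ler_norml; have [?|?] := ler0P (dot v b); apply/andP; split; lra.
apply: caratheodory_measurable_setU; apply: caratheodory_measurable_setI;
  exact: halfspace_caratheodory.
Qed.

Lemma bigcap_caratheodory (I : finType) (A : I -> set 'rV[R]_n.+1) :
  (forall i, (sigma).-caratheodory (A i)) -> (sigma).-caratheodory [set v | forall i, A i v].
Proof.
move=> mA; rewrite (_ : [set v | _] = \big[setI/setT]_(i <- enum I) A i); last first.
  by apply/seteqP; split => v; rewrite -bigcap_seq => Av i; [move=> _; exact: Av|exact: Av (mem_enum _ _)].
elim: (enum I) => [|i s IH]; rewrite ?big_nil ?big_cons.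
  by rewrite -setC0; exact/caratheodory_measurable_setC/caratheodory_measurable_set0.
exact: caratheodory_measurable_setI.
Qed.

Lemma sphere_measure_null (c : 'rV[R]_n.+1) : c != 0 ->
  sigma [set v | dot v c = 0] = 0%E.
Proof. by move=> c0; rewrite /sphere_measure setIC hausdorff_subsphere. Qed.

Section Cells.
Context {I : finType} (w : I -> 'rV[R]_n.+1).

Definition normal_cone (a : I) : set 'rV[R]_n.+1 :=
  [set v | forall b, dot v (w b) <= dot v (w a)].

Lemma normal_cone_caratheodory a : (sigma).-caratheodory (normal_cone a).
Proof.
apply: bigcap_caratheodory => b.
rewrite (_ : (fun v => _) = [set v | dot v (w b - w a) <= 0]).
  exact: halfspace_caratheodory.
by apply/funext => v; rewrite /= dotBr subr_le0.
Qed.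

(** Both maxima are attained only on the hyperplane orthogonal to [w a - w b], which cuts the sphere
    in a null set. *)
Lemma sphere_measure_normal_coneI a b : injective w -> a != b ->
  sigma (normal_cone a `&` normal_cone b) = 0%E.
Proof.
move=> winj ab; have wab : w a - w b != 0.
  by rewrite subr_eq0; apply: contra ab => /eqP /winj ->.
apply/eqP; rewrite eq_le sphere_measure_ge0 andbT -(sphere_measure_null wab).
apply: le_sphere_measure => v [va vb]; rewrite /= dotBr; apply/eqP.
by rewrite subr_eq0 eq_le va vb.
Qed.

Lemma sphere_measure_normal_cones (P : pred I) : injective w ->
  sigma (\big[setU/set0]_(a | P a) normal_cone a)
    = (\sum_(a | P a) sigma (normal_cone a))%E.
Proof.
move=> winj; rewrite -big_filter -[RHS]big_filter.
apply: outer_measure_bigsetU_null => [||a b].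
- by rewrite filter_uniq // index_enum_uniq.
- exact: normal_cone_caratheodory.
- exact: sphere_measure_normal_coneI.
Qed.

End Cells.

End SphereMeasure.

(** * The integral of the logarithm of the support function *)

Section Variational.
Context {R : realType} {n N : nat}.
Variable u : 'I_N -> 'rV[R]_n.+1.
Hypothesis u_unit : forall i, enorm (u i) = 1.
Hypothesis u_span : forall v, (forall i, dot v (u i) = 0) -> v = 0.
Implicit Types (x y : 'rV[R]_N) (v : 'rV[R]_n.+1) (i j : 'I_N) (t : R).
Local Notation S := (unit_sphere (R := R) (n := n)).
Local Notation sigma := (@sphere_measure R n).

(** The support function of the convex hull of the points +-exp(x_i) u_i. *)
Definition max_proj x v : R := \big[Num.max/0]_i (expR (x 0 i) * `|dot v (u i)|).

Lemma max_proj_ge x v i : expR (x 0 i) * `|dot v (u i)| <= max_proj x v.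
Proof. by apply/bigmax_geP; right; exists i. Qed.

Lemma max_proj_ge0 x v : 0 <= max_proj x v.
Proof. by apply/bigmax_geP; left. Qed.

Lemma max_proj_le x v (b : R) : 0 <= b ->
  (forall i, expR (x 0 i) * `|dot v (u i)| <= b) -> max_proj x v <= b.
Proof. by move=> b0 h; apply/bigmax_leP; split. Qed.

Lemma max_proj_gt0 x v : S v -> 0 < max_proj x v.
Proof.
move=> vS; rewrite lt_neqAle max_proj_ge0 andbT; apply/eqP => h0.
suff v0 : v = 0 by have := unit_sphere_dot vS; rewrite v0 dot0l => /eqP; rewrite eq_sym oner_eq0.
apply: u_span => i; have := max_proj_ge x v i; rewrite -h0.
by rewrite pmulr_rle0 ?expR_gt0 // normr_le0 => /eqP.
Qed.

(** The normals at one of the two points +-exp(x_i) u_i: a union of two opposite normal cones, by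
    [cell_normal_cone]. *)
Definition cell x i : set 'rV[R]_n.+1 :=
  [set v | forall j, expR (x 0 j) * `|dot v (u j)| <= expR (x 0 i) * `|dot v (u i)|].

Lemma cell_caratheodory x i : (sigma).-caratheodory (cell x i).
Proof.
apply: bigcap_caratheodory => j.
have := abs_dot_le_caratheodory (expR (x 0 j) *: u j) (expR (x 0 i) *: u i).
congr (caratheodory_measurable _ _); apply/funext => v /=.
by rewrite !dotZr !normrM !(ger0_norm (expR_ge0 _)).
Qed.

Lemma cell_shift x t i : cell (x + const_mx t) i = cell x i.
Proof.
move yE : (x + const_mx t) => y.
have E v j : expR (y 0 j) * `|dot v (u j)| = expR (x 0 j) * `|dot v (u j)| * expR t.
  by rewrite -yE !mxE expRD mulrAC.
by apply/funext => v; apply/propext; split => h j; have := h j;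
  rewrite (E v j) (E v i) ler_pM2r ?expR_gt0.
Qed.

Lemma max_proj_attained x v : S v ->
  exists i, max_proj x v = expR (x 0 i) * `|dot v (u i)|.
Proof.
move=> vS; apply: contrapT => /forallNP ne.
suff : max_proj x v < max_proj x v by rewrite ltxx.
apply/bigmax_ltP; split=> [|i _]; first exact: max_proj_gt0.
by rewrite lt_neqAle max_proj_ge andbT eq_sym; apply/eqP/ne.
Qed.

(* The denominator makes the logarithm bounded on the sphere by the largest
   coordinate of [x], without a compactness argument. *)
Definition log_ratio x v : R := ln (max_proj x v / max_proj 0 v).

(** Without maxima, a sublevel set is a finite combination of the comparisons treated in
    [abs_dot_le_caratheodory], hence measurable. *)
Lemma log_ratio_leP x v t : S v ->
  log_ratio x v <= t <->
  forall i, exists j, expR (x 0 i) * `|dot v (u i)| <= expR t * `|dot v (u j)|.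
Proof.
move=> vS; have x0 := max_proj_gt0 x vS; have z0 := max_proj_gt0 0 vS.
have zE j : expR ((0 : 'rV[R]_N) 0 j) * `|dot v (u j)| = `|dot v (u j)|.
  by rewrite mxE expR0 mul1r.
have -> : (log_ratio x v <= t) = (max_proj x v <= expR t * max_proj 0 v).
  by rewrite -ler_expR lnK ?posrE ?divr_gt0 // ler_pdivrMr.
split=> [h i|h].
  have [j jE] := max_proj_attained 0 vS.
  by exists j; rewrite -[`|dot v (u j)|]zE -jE (le_trans (max_proj_ge x v i)).
apply: max_proj_le => [|i]; first by rewrite mulr_ge0 ?expR_ge0 ?ltW.
have [j /le_trans] := h i; apply; rewrite ler_pM2l ?expR_gt0 // -zE.
exact: max_proj_ge.
Qed.

Lemma log_ratio_le x y v t : S v ->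
  max_proj x v <= expR t * max_proj y v -> log_ratio x v <= log_ratio y v + t.
Proof.
move=> vS xy; have x0 := max_proj_gt0 x vS; have y0 := max_proj_gt0 y vS.
have z0 := max_proj_gt0 0 vS.
rewrite /log_ratio !ln_div ?posrE // addrAC lerD2r -[t in leRHS]expRK.
by rewrite -lnM ?posrE ?expR_gt0 // ler_ln ?posrE ?mulr_gt0 ?expR_gt0 // mulrC.
Qed.

Let om : {outer_measure set 'rV[R]_n.+1 -> \bar R} := sigma.
Let mu : {measure set (caratheodory_type om) -> \bar R} := om.

Lemma measurable_log_ratio x :
  measurable_fun (S : set (caratheodory_type om)) (log_ratio x).
Proof.
move=> mS; apply: (measurability _ (RGenOInfty.measurableE R)) => //.
move=> /= _ [_ [t ->] <-].
pose Q i := [set v | exists j, `|dot v (expR (x 0 i) *: u i)| <= `|dot v (expR t *: u j)|].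
have mQ i : (sigma).-caratheodory (Q i).
  rewrite (_ : Q i = ~` [set v | forall j, (~` [set v' |
      `|dot v' (expR (x 0 i) *: u i)| <= `|dot v' (expR t *: u j)|]) v]).
    apply/caratheodory_measurable_setC/bigcap_caratheodory => j.
    exact/caratheodory_measurable_setC/abs_dot_le_caratheodory.
  apply/funext => v; apply/propext; rewrite /Q /=; split=> [[j h] /(_ j)|h]; first exact.
  by apply: contrapT => /forallNP.
have -> : S `&` log_ratio x @^-1` `]t, +oo[%classic = S `\` [set v | forall i, Q i v].
  apply/funext => v; apply/propext; rewrite /= in_itv /= andbT ltNge.
  split=> -[vS h]; split => //.
    move=> hQ; move/negP: h; apply; apply/(log_ratio_leP x t vS) => i.
    have [j] := hQ i; rewrite !dotZr !normrM !(ger0_norm (expR_ge0 _)).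
    by exists j.
  apply/negP => /(log_ratio_leP x t vS) h'; apply: h => i.
  have [j] := h' i; exists j.
  by rewrite !dotZr !normrM !(ger0_norm (expR_ge0 _)).
apply: measurableD => //.
exact: (@bigcap_caratheodory R n _ Q).
Qed.

(** The outer measure ignores everything off the sphere. *)
Lemma measurable_sphere : measurable (S : set (caratheodory_type om)).
Proof.
apply: le_caratheodory_measurable => X.
by rewrite /= /sphere_measure -!setIA setICl setI0 hausdorff_set0 adde0 setIid.
Qed.

Let muS : (mu S < +oo)%E := sphere_measure_lty S.

Lemma max_proj_shift_le x y v (d : R) :
  (forall i, x 0 i <= y 0 i + d) -> max_proj x v <= expR d * max_proj y v.
Proof.
move=> xy; apply: max_proj_le => [|i]; first by rewrite mulr_ge0 ?expR_ge0 ?max_proj_ge0.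
apply: le_trans (ler_wpM2l (expR_ge0 d) (max_proj_ge y v i)).
by rewrite mulrA -expRD ler_wpM2r // ler_expR addrC.
Qed.

Lemma integrable_log_ratio x : mu.-integrable S (EFin \o log_ratio x).
Proof.
apply: measurable_bounded_integrable => //.
- exact: measurable_sphere.
- exact: measurable_log_ratio.
- exists `|x|; split; first exact: num_real.
  move=> M xM v vS /=.
  have lr0 : log_ratio 0 v = 0 by rewrite /log_ratio divff ?ln1 // gt_eqF // max_proj_gt0.
  have h1 : log_ratio x v <= log_ratio 0 v + `|x|.
    apply: log_ratio_le => //; apply: max_proj_shift_le => i.
    by rewrite mxE add0r (le_trans (ler_norm _)) // coord_le_norm.
  have h2 : log_ratio 0 v <= log_ratio x v + `|x|.
    apply: log_ratio_le => //; apply: max_proj_shift_le => i.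
    by rewrite mxE -lerBlDr sub0r lerNl (le_trans (ler_norm _)) // normrN coord_le_norm.
  by rewrite ler_norml; apply/andP; split; lra.
Qed.

Definition mean_log x : R := \int[mu]_(v in S) log_ratio x v.

Definition mass (D : set 'rV[R]_n.+1) : R := fine (sigma D).

(** Taken with [D] the whole space this gives the Lipschitz bound and the effect of a shift; with
    [D] a cell, the effect of moving one coordinate. *)
Lemma mean_log_le x y t (D : set 'rV[R]_n.+1) : (sigma).-caratheodory D ->
  (forall v, S v -> log_ratio x v <= log_ratio y v + t * \1_D v) ->
  mean_log x <= mean_log y + t * mass D.
Proof.
move=> mD xy; have mS := measurable_sphere.
have iD : mu.-integrable S (EFin \o (fun v => t * \1_D v)).
  apply: (@measurable_bounded_integrable _ _ _ mu (fun v => t * \1_D v) S mS muS).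
    have tD := @measurable_funM _ (caratheodory_type om) R S (cst t) \1_D.
    by apply: tD; [exact: measurable_cst|exact: measurable_indic].
  exists `|t|; split; first exact: num_real.
  move=> M tM v _ /=; apply: le_trans (ltW tM); rewrite normrM ler_piMr //.
  by rewrite indicE; case: (_ \in _); rewrite ?normr1 ?normr0.
have -> : t * mass D = \int[mu]_(v in S) (t * \1_D v).
  rewrite RintegralZl //; last first.
    apply: (@measurable_bounded_integrable _ _ _ mu \1_D S mS muS).
      exact: measurable_indic.
    exists 1; split => // M M1 v _ /=; apply: le_trans (ltW M1).
    by rewrite indicE; case: (_ \in _); rewrite ?normr1 ?normr0.
  congr (_ * _); rewrite /Rintegral integral_indic // /mass /=.
  by rewrite /sphere_measure -setIA setIid.
rewrite -RintegralD //; [|exact: integrable_log_ratio..].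
apply: le_Rintegral => //; first exact: integrable_log_ratio.
have -> : (EFin \o (fun v => log_ratio y v + t * \1_D v)) =
  ((EFin \o log_ratio y) \+ (EFin \o (fun v => (t * \1_D v)%R)))%E by [].
by apply: integrableD => //; exact: integrable_log_ratio.
Qed.

End Variational.

(** * Normal cones at the signed vertices, and their masses *)

Section SignedVertices.
Context {R : realType} {n N : nat}.
Variable u : 'I_N -> 'rV[R]_n.+1.
Hypothesis u_unit : forall i, enorm (u i) = 1.
Hypothesis u_indep : forall i j, i != j -> u i != u j /\ u i != - u j.
Implicit Types (x : 'rV[R]_N) (i j : 'I_N).
Local Notation sigma := (@sphere_measure R n).

Definition vertex x (a : 'I_N * bool) : 'rV[R]_n.+1 :=
  ((-1) ^+ a.2 * expR (x 0 a.1)) *: u a.1.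

Lemma dot_vertex x v a :
  dot v (vertex x a) = (-1) ^+ a.2 * (expR (x 0 a.1) * dot v (u a.1)).
Proof. by rewrite dotZr mulrA. Qed.

Lemma vertexN x i b : vertex x (i, ~~ b) = - vertex x (i, b).
Proof. by rewrite /vertex /= signrN mulNr scaleNr. Qed.

Lemma enorm_vertex x a : enorm (vertex x a) = expR (x 0 a.1).
Proof.
by rewrite enormZ u_unit mulr1 normrM normrX normrN1 expr1n mul1r ger0_norm ?expR_ge0.
Qed.

Lemma vertex_inj x : injective (vertex x).
Proof.
move=> [i a] [j b] ab; have := congr1 (@enorm R _) ab.
rewrite !enorm_vertex /= => eij; have e0 : expR (x 0 j) != 0 by rewrite gt_eqF ?expR_gt0.
move: ab; rewrite /vertex /= eij !(mulrC _ (expR _)) -!scalerA => /(scalerI e0) ab.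
have [ij|ij] := eqVneq i j.
  rewrite ij in ab *; congr (_, _).
  have [//|nab] := eqVneq a b.
  have bE : b = ~~ a by move: nab; case: (a); case: (b).
  move: ab; rewrite bE signrN scaleNr => /eqP; rewrite -addr_eq0 -mulr2n -scaler_nat.
  rewrite !scaler_eq0 pnatr_eq0 signr_eq0 /= => /eqP uj0.
  by have := u_unit j; rewrite uj0 /enorm dot0l sqrtr0 => /eqP; rewrite eq_sym oner_eq0.
have [h1 h2] := u_indep ij; move: ab; case: a b => -[] /=;
  rewrite ?scaleN1r ?scale1r ?expr1 ?expr0 ?scaleN1r ?scale1r => /eqP.
- by rewrite eqr_opp (negbTE h1).
- by rewrite eqr_oppLR (negbTE h2).
- by rewrite (negbTE h2).
- by rewrite (negbTE h1).
Qed.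

Lemma normal_cone_vertexN x i b :
  normal_cone (vertex x) (i, ~~ b) = [set - v | v in normal_cone (vertex x) (i, b)].
Proof.
have dotN v j c : dot (- v) (vertex x (j, ~~ c)) = dot v (vertex x (j, c)).
  by rewrite vertexN dotNl dotNr opprK.
apply/seteqP; split => [v vi|_ [v vi <-] [j c]].
  exists (- v); last by rewrite opprK.
  by move=> [j c]; rewrite -(dotN (- v) j c) -(dotN (- v) i b) opprK; exact: vi.
by rewrite -[c]negbK (dotN v j) (dotN v i); exact: vi.
Qed.

Lemma normal_cone_vertex_mass x i b :
  sigma (normal_cone (vertex x) (i, b)) = sigma (normal_cone (vertex x) (i, false)).
Proof.
by case: b => //; rewrite (normal_cone_vertexN x i false) sphere_measureN.
Qed.

Lemma cell_normal_cone x i : cell u x i =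
  normal_cone (vertex x) (i, false) `|` normal_cone (vertex x) (i, true).
Proof.
have le v a : dot v (vertex x a) <= expR (x 0 a.1) * `|dot v (u a.1)|.
  rewrite dot_vertex (le_trans (ler_norm _)) // normrM normrX normrN1 expr1n mul1r.
  by rewrite normrM ger0_norm ?expR_ge0.
apply/seteqP; split => v.
  move=> vi; have [v0|v0] := leP 0 (dot v (u i)); [left|right] => a;
    apply: le_trans (le v a) _; apply: le_trans (vi a.1) _; rewrite dot_vertex /=.
    by rewrite ger0_norm // expr0 mul1r.
  by rewrite ltr0_norm // expr1 mulN1r mulrN.
have ge v' b j : expR (x 0 j) * `|dot v' (u j)| <= b <->
    forall c, dot v' (vertex x (j, c)) <= b.
  split=> [h c|h]; first exact: (le_trans (le v' (j, c)) h).
  have [v0|v0] := leP 0 (dot v' (u j)).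
    by have := h false; rewrite dot_vertex /= expr0 mul1r ger0_norm.
  by have := h true; rewrite dot_vertex /= expr1 mulN1r ltr0_norm // mulrN.
by case=> vi j; apply/ge => c;
  [exact: (le_trans (vi (j, c)) (le v (i, false)))
  |exact: (le_trans (vi (j, c)) (le v (i, true)))].
Qed.

Lemma massE (D : set 'rV[R]_n.+1) : (mass D)%:E = sigma D.
Proof. by rewrite fineK // sphere_measure_fin. Qed.

Lemma cell_mass x i :
  mass (cell u x i) = 2 * mass (normal_cone (vertex x) (i, false)).
Proof.
apply: EFin_inj; rewrite EFinM !massE cell_normal_cone.
have us : uniq [:: (i, false); (i, true)] by rewrite /= inE xpair_eqE andbF.
have := @outer_measure_bigsetU_null _ _ sigma _ _ (normal_cone (vertex x)) us.
rewrite !big_cons !big_nil setU0 adde0 /= (normal_cone_vertex_mass x i true) => ->.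
- by rewrite -massE -EFinD -EFinM mulr_natl mulr2n.
- exact: normal_cone_caratheodory.
- by move=> a b; apply: sphere_measure_normal_coneI; exact: vertex_inj.
Qed.

(** The normal cones overlap in null sets, so their masses add up. This upper bound later turns the
    lower bounds on the cells into equalities. *)
Lemma sum_cell_mass x : \sum_i mass (cell u x i) <= mass (setT : set 'rV[R]_n.+1).
Proof.
rewrite -lee_fin massE.
apply: le_trans (le_outer_measure sigma _ _ (@subsetT _
  (\big[setU/set0]_(a | xpredT a) normal_cone (vertex x) a))).
rewrite /= (sphere_measure_normal_cones _ (@vertex_inj x)) -sumEFin.
rewrite -(pair_bigA _ (fun i b => sigma (normal_cone (vertex x) (i, b)))) /=.
apply: lee_sum => i _; rewrite big_bool /= (normal_cone_vertex_mass x i true) -!massE.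
by rewrite cell_mass -EFinD lee_fin mulr_natl mulr2n.
Qed.

End SignedVertices.

(** * The objective function and its one-sided variation *)

Section Minimisation.
Context {R : realType} {n N : nat}.
Variable u : 'I_N -> 'rV[R]_n.+1.
Hypothesis u_unit : forall i, enorm (u i) = 1.
Hypothesis u_span : forall v, (forall i, dot v (u i) = 0) -> v = 0.
Hypothesis u_indep : forall i j, i != j -> u i != u j /\ u i != - u j.
Variables (m : 'I_N -> R) (q : R).
Hypothesis m_gt0 : forall i, 0 < m i.
Hypothesis q01 : 0 < q < 1.
Hypothesis N_gt0 : (0 < N)%N.
Implicit Types (x y : 'rV[R]_N) (i j : 'I_N) (t : R).
Local Notation S := (unit_sphere (R := R) (n := n)).
Local Notation sigma := (@sphere_measure R n).
Local Notation s := (mass (setT : set 'rV[R]_n.+1)).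
Local Notation Phi := (mean_log u).
Local Notation e_ i := (delta_mx 0 i : 'rV[R]_N).

Let q0 : 0 < q. Proof. by case/andP: q01. Qed.
Let q1 : q < 1. Proof. by case/andP: q01. Qed.

Lemma massT_gt0 : 0 < s.
Proof. by rewrite -lte_fin massE sphere_measureT_gt0. Qed.

Let s0 := massT_gt0.

Lemma setT_caratheodory : (sigma).-caratheodory setT.
Proof. by move=> X; rewrite setIT setCT setI0 outer_measure0 adde0. Qed.

Lemma strip_mass : exists2 C : R, 0 < C &
  forall j (e : R), 0 < e -> mass [set v | `|dot v (u j)| <= e] <= C * e.
Proof.
have /choice[C hC] : forall j, exists C : R, 0 <= C /\ forall e : R, 0 < e ->
    mass [set v | `|dot v (u j)| <= e] <= C * e.
  move=> j; have uj0 : u j != 0 by rewrite -enorm_gt0 u_unit.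
  have [C [C0 hC]] := hausdorff_strip uj0; exists C; split => // e e0.
  by rewrite -lee_fin massE /sphere_measure setIC hC.
have C0 : 0 <= \sum_j C j by apply: sumr_ge0 => j _; have [] := hC j.
exists (\sum_j C j + 1); first by rewrite ltr_wpDl.
move=> j e e0; have [_ /(_ e e0) h] := hC j; apply: le_trans h _.
rewrite ler_wpM2r ?(ltW e0) // (bigD1 j) //= -addrA lerDl addr_ge0 //.
by apply: sumr_ge0 => k _; have [] := hC k.
Qed.

Lemma mean_log_lip x y : Phi x <= Phi y + `|x - y| * s.
Proof.
apply: mean_log_le => //; first exact: setT_caratheodory.
move=> v vS; rewrite indicT mulr1; apply: log_ratio_le => //.
apply: max_proj_shift_le => i; rewrite -lerBlDl.
have := coord_le_norm (x - y) i; rewrite !mxE; exact/le_trans/ler_norm.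
Qed.

Lemma mean_log_shift x t : Phi (x + const_mx t) = Phi x + t * s.
Proof.
apply/eqP; rewrite eq_le; apply/andP; split.
  apply: mean_log_le => //; first exact: setT_caratheodory.
  move=> v vS; rewrite indicT mulr1; apply: log_ratio_le => //.
  by apply: max_proj_shift_le => i; rewrite !mxE.
rewrite -lerBrDr -mulNr; apply: mean_log_le => //; first exact: setT_caratheodory.
move=> v vS; rewrite indicT mulr1; apply: log_ratio_le => //.
by apply: max_proj_shift_le => i; rewrite !mxE addrK.
Qed.

(* Only on the new cell can the maximum of the projections have moved. *)
Lemma mean_log_step x i t : 0 < t ->
  Phi (x + t *: e_ i) <= Phi x + t * mass (cell u (x + t *: e_ i) i).
Proof.
move=> t0; apply: mean_log_le => //; first exact: cell_caratheodory.
move=> v vS; rewrite indicE.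
move yE : (x + t *: e_ i) => y.
have yj j : y 0 j = x 0 j + t * (j == i)%:R by rewrite -yE !mxE eqxx.
case: (boolP (v \in cell u y i)) => [_|/negP vi].
  rewrite mulr1; apply: log_ratio_le => //; apply: max_proj_shift_le => j.
  by rewrite yj lerD2l; case: eqP => _; rewrite ?mulr1 // mulr0 ltW.
have [k kE] := max_proj_attained u_span y vS.
have ki : (k == i) = false.
  apply/negP => /eqP ki; apply: vi; rewrite inE => j.
  by rewrite -ki -kE max_proj_ge.
rewrite mulr0; apply: log_ratio_le => //.
by rewrite expR0 mul1r kE yj ki mulr0 addr0 max_proj_ge.
Qed.

Definition weight_sum x : R := \sum_i m i * expR (q * x 0 i).

Lemma weight_sum_gt0 x : 0 < weight_sum x.
Proof.
rewrite /weight_sum (bigD1 (Ordinal N_gt0)) //= ltr_wpDr ?mulr_gt0 ?expR_gt0 //.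
by apply: sumr_ge0 => i _; rewrite mulr_ge0 ?expR_ge0 ?ltW.
Qed.

Lemma weight_sum_le x y t : (forall i, x 0 i <= y 0 i + t) ->
  weight_sum x <= expR (q * t) * weight_sum y.
Proof.
move=> xy; rewrite mulr_sumr; apply: ler_sum => i _.
rewrite mulrCA -expRD ler_pM2l // ler_expR -mulrDr addrC.
by rewrite ler_pM2l.
Qed.

Lemma weight_sum_shift x t :
  weight_sum (x + const_mx t) = expR (q * t) * weight_sum x.
Proof.
rewrite mulr_sumr; apply: eq_bigr => i _.
by rewrite !mxE mulrCA -expRD mulrDr [in RHS]addrC.
Qed.

(** The factor [s / q] makes both terms grow by [t * s] when [t] is added to all coordinates. *)
Definition objective x : R := Phi x - s / q * ln (weight_sum x).

Lemma objective_shift x t : objective (x + const_mx t) = objective x.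
Proof.
rewrite /objective mean_log_shift weight_sum_shift.
rewrite lnM ?posrE ?expR_gt0 ?weight_sum_gt0 // expRK.
by field; rewrite gt_eqF.
Qed.

Lemma objective_le x y : objective x <= objective y + 2 * s * `|x - y|.
Proof.
have h1 := mean_log_lip x y.
have h2 : ln (weight_sum y) <= q * `|x - y| + ln (weight_sum x).
  rewrite -[q * _]expRK -lnM ?posrE ?expR_gt0 ?weight_sum_gt0 //.
  rewrite ler_ln ?posrE ?mulr_gt0 ?expR_gt0 ?weight_sum_gt0 //.
  apply: weight_sum_le => i; rewrite -lerBlDl.
  by have := coord_le_norm (y - x) i; rewrite distrC !mxE; exact/le_trans/ler_norm.
have sq0 : 0 <= s / q by rewrite ltW ?divr_gt0.
have h3 := ler_wpM2l sq0 h2.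
have h4 : s / q * (q * `|x - y| + ln (weight_sum x)) =
    s * `|x - y| + s / q * ln (weight_sum x) by field; rewrite gt_eqF.
rewrite /objective; move: h1 h3; rewrite {}h4.
move: (Phi x) (Phi y) (s / q * ln (weight_sum x)) (s / q * ln (weight_sum y)) => a b c d.
by rewrite [`|x - y| * s]mulrC -mulrA; move: (s * `|x - y|) => e; lra.
Qed.

Lemma continuous_objective : continuous objective.
Proof.
apply: (@lipschitz_continuous _ _ R^o _ (2 * s)) => x y.
have := objective_le x y; have := objective_le y x.
rewrite [`|y - x|]distrC ler_norml; move: (objective x) (objective y) (2 * s * _) => a b c.
by move=> ? ?; apply/andP; split; lra.
Qed.

(** Raising x_i by [t] multiplies the weight sum by at least 1 + q t a, where [a] is the share of
    the i-th term. The new cell has to pay for this gain in the logarithm; the factor [1 - q * t]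
    covers the second-order loss. *)
Lemma cell_mass_ge x i t : 0 < t -> objective x <= objective (x + t *: e_ i) ->
  s * (m i * expR (q * x 0 i) / weight_sum x) * (1 - q * t)
    <= mass (cell u (x + t *: e_ i) i).
Proof.
move=> t0 le_obj; set a := m i * expR (q * x 0 i) / weight_sum x.
have Z0 := weight_sum_gt0 x.
have a0 : 0 < a by rewrite divr_gt0 // mulr_gt0 // expR_gt0.
have a1 : a <= 1.
  rewrite ler_pdivrMr // mul1r /weight_sum (bigD1 i) //= lerDl.
  by apply: sumr_ge0 => j _; rewrite mulr_ge0 ?expR_ge0 ?ltW.
have qt0 : 0 < q * t by rewrite mulr_gt0.
pose b := q * t * a; have b0 : 0 < b by rewrite mulr_gt0.
have Zt : weight_sum x * (1 + b) <= weight_sum (x + t *: e_ i).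
  have -> : weight_sum x * (1 + b) =
      weight_sum x + m i * expR (q * x 0 i) * (q * t).
    by rewrite /b /a; field; rewrite gt_eqF.
  rewrite /weight_sum (bigD1 i) //= [in leRHS](bigD1 i) //= addrAC lerD //.
    have -> : m i * expR (q * (x + t *: e_ i) 0 i) =
        m i * expR (q * x 0 i) * expR (q * t).
      by rewrite !mxE !eqxx mulr1 mulrDr expRD mulrA.
    by rewrite -[X in X + _]mulr1 -mulrDr ler_pM2l ?mulr_gt0 ?expR_gt0 // expR_ge1Dx.
  rewrite le_eqVlt; apply/orP; left; apply/eqP; apply: eq_bigr => j ji.
  by rewrite !mxE (negbTE ji) andbF mulr0 addr0.
have b1 : 0 < 1 + b by rewrite addr_gt0.
(* This is ln (1 + y) <= y at y = - b / (1 + b), where 1 + y is the inverse of 1 + b. *)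
have lnb : b / (1 + b) <= ln (1 + b).
  have e : 1 + - (b / (1 + b)) = (1 + b)^-1 by field; rewrite gt_eqF.
  have := @le_ln1Dx _ (- (b / (1 + b))); rewrite e lnV ?posrE // lerN2; apply.
  by rewrite ltrN2 ltr_pdivrMr // mul1r; lra.
have bb : b * (1 - q * t) <= b / (1 + b).
  rewrite ler_pdivlMr // -mulrA ler_piMr ?(ltW b0) //.
  have bqt : b <= q * t by rewrite /b ler_piMr // ltW.
  have : 0 <= q * t * b by rewrite mulr_ge0 // ltW.
  by move=> ?; rewrite mulrDr mulr1 mulrBl mul1r; lra.
have lnZ : ln (weight_sum x) + ln (1 + b) <= ln (weight_sum (x + t *: e_ i)).
  by rewrite -lnM ?posrE // ler_ln ?posrE ?mulr_gt0 ?weight_sum_gt0.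
have step := mean_log_step x i t0.
have sq0 : 0 < s / q by rewrite divr_gt0.
have main : s / q * (b * (1 - q * t)) <= t * mass (cell u (x + t *: e_ i) i).
  have := ler_wpM2l (ltW sq0) (le_trans (lerD (lexx (ln (weight_sum x))) (le_trans bb lnb)) lnZ).
  move: step le_obj; rewrite /objective mulrDr.
  move: (Phi _) (Phi _) (s / q * ln _) (s / q * ln _) (s / q * (b * _)) (t * mass _).
  by move=> c1 c2 c3 c4 c5 c6; lra.
rewrite -(ler_pM2l t0); apply: le_trans main.
by rewrite /b le_eqVlt; apply/orP; left; apply/eqP; field; rewrite gt_eqF.
Qed.

End Minimisation.

(** * A point at which no small increase of a coordinate lowers the objective *)

Section MinimiserExists.
Context {R : realType} {n N : nat}.
Variable u : 'I_N -> 'rV[R]_n.+1.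
Hypothesis u_unit : forall i, enorm (u i) = 1.
Hypothesis u_span : forall v, (forall i, dot v (u i) = 0) -> v = 0.
Hypothesis u_indep : forall i j, i != j -> u i != u j /\ u i != - u j.
Variables (m : 'I_N -> R) (q : R).
Hypothesis m_gt0 : forall i, 0 < m i.
Hypothesis q01 : 0 < q < 1.
Hypothesis N_gt0 : (0 < N)%N.
Implicit Types (x y : 'rV[R]_N) (i j : 'I_N) (t : R).
Local Notation S := (unit_sphere (R := R) (n := n)).
Local Notation sigma := (@sphere_measure R n).
Local Notation s := (mass (setT : set 'rV[R]_n.+1)).
Local Notation e_ i := (delta_mx 0 i : 'rV[R]_N).
Local Notation G := (objective u m q).

Let q0 : 0 < q. Proof. by case/andP: q01. Qed.
Let q1 : q < 1. Proof. by case/andP: q01. Qed.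
Let s0 : 0 < s := massT_gt0.

Let step_coord x i t j : (x + t *: e_ i) 0 j = x 0 j + t * (j == i)%:R.
Proof. by rewrite !mxE eqxx. Qed.

Lemma exists_minimiser (L : R) : 0 <= L -> exists x,
  [/\ forall i, - L <= x 0 i <= 0, exists j, x 0 j = 0 &
      forall y, (forall i, - L <= y 0 i <= 0) -> G x <= G y].
Proof.
move=> L0; pose B := [set x : 'rV[R]_N | forall i, x ord0 i \in `[- L, 0]].
have Bc : compact B.
  apply: (@rV_compact _ _ (fun=> `[- L, 0]%classic)) => i; exact: segment_compact.
have B0 : B !=set0 by exists 0 => i; rewrite mxE in_itv /= oppr_le0 L0 lexx.
have Gc : {within B, continuous G}.
  by apply: continuous_subspaceT; exact: continuous_objective.
have [x0 /set_mem x0B x0min] := EVT_min_rV B0 Bc Gc.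
pose j := [arg max_(i > Ordinal N_gt0) x0 0 i]%O.
have jmax i : x0 0 i <= x0 0 j by rewrite /j; case: arg_maxP => // k _; exact.
have x0b i : - L <= x0 0 i <= 0 by have := x0B i; rewrite in_itv.
exists (x0 + const_mx (- x0 0 j)); split.
- move=> i; rewrite !mxE; have := x0b i; have := x0b j; have := jmax i.
  by move=> ? /andP[? ?] /andP[? ?]; apply/andP; split; lra.
- by exists j; rewrite !mxE subrr.
(* Moving the largest coordinate of the minimiser to 0 stays in the box and preserves the value. *)
- move=> y yb; rewrite objective_shift //; apply: x0min; rewrite inE => i.
  by rewrite in_itv; exact: yb.
Qed.

(* At a coordinate equal to [- L], the cell is squeezed into a strip of mass
   O(exp (- L)), while [cell_mass_ge] bounds it below by a multiple of
   exp (- q L): a contradiction for large [L], since [q < 1]. *)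
Lemma interior_minimiser : exists x (d : R), 0 < d /\
  forall i t, 0 < t -> t <= d -> G x <= G (x + t *: e_ i).
Proof.
have [C C0 strip] := strip_mass u_unit.
pose M := \sum_i m i.
have M0 : 0 < M.
  rewrite /M (bigD1 (Ordinal N_gt0)) //= ltr_wpDr //.
  by apply: sumr_ge0 => i _; exact: ltW.
pose b i := 2 * M * (C * expR 2^-1) / (s * m i).
have b0 i : 0 < b i.
  apply: divr_gt0; last by rewrite mulr_gt0.
  by apply: mulr_gt0; apply: mulr_gt0 => //; exact: expR_gt0.
(* A coordinate equal to [- L] will force exp ((1 - q) L) <= b i, whereas for this [L] the left side
   is at least the sum of all [b i] plus 2. *)
pose L := (\sum_i b i + 1) / (1 - q).
have q1' : 0 < 1 - q by rewrite subr_gt0.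
have sb0 : 0 <= \sum_i b i by apply: sumr_ge0 => i _; exact: ltW.
have L1 : 1 <= L by rewrite ler_pdivlMr // mul1r; have := q0; lra.
have [|x [xb [j xj0] xmin]] := @exists_minimiser L; first exact: le_trans L1.
have xL i : - L < x 0 i.
  have /andP[xi _] := xb i; rewrite lt_neqAle xi andbT; apply/negP => /eqP xiL.
  have ij : (j == i) = false.
    by apply/negP => /eqP ji; move: xj0; rewrite ji -xiL; move: L1; lra.
  (* The step 1/2 stays inside the box because [L] is at least 1. *)
  have t0 : 0 < 2^-1 :> R by rewrite invr_gt0.
  have le_obj : G x <= G (x + 2^-1 *: e_ i).
    apply: xmin => k; rewrite step_coord; have /andP[h1 h2] := xb k.
    have [ki|ki] := eqVneq k i; last by rewrite mulr0 addr0 h1 h2.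
    by rewrite mulr1 ki -xiL; move: L1 => ?; apply/andP; split; lra.
  have := cell_mass_ge u_span m_gt0 q01 N_gt0 t0 le_obj.
  set y := x + _; rewrite -xiL => lower.
  (* Since x_j = 0, a unit normal [v] in the cell of [i] satisfies |v . u_j| <= exp (- L + 1/2). *)
  have upper : mass (cell u y i) <= C * expR (- L + 2^-1).
    apply: le_trans (strip j _ (expR_gt0 _)).
    rewrite -lee_fin !massE; apply: le_hausdorff => v [vc vS]; split => //=.
    have := vc j; rewrite !step_coord ij eqxx mulr0 mulr1 xj0 addr0 expR0 mul1r -xiL.
    move/le_trans; apply; rewrite ler_piMr ?expR_ge0 //.
    by apply: le_trans (norm_dot_le _ _) _; rewrite vS u_unit mulr1.
  have ZM : weight_sum m q x <= M.
    apply: ler_sum => k _; rewrite ler_piMr ?(ltW (m_gt0 k)) //.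
    by rewrite -expR0 ler_expR mulr_ge0_le0 ?(ltW q0) //; case/andP: (xb k).
  have Z0 := weight_sum_gt0 q m_gt0 N_gt0 x.
  have half : 2^-1 <= 1 - q * 2^-1 by have := q1; lra.
  have sm : 0 < s * m i by rewrite mulr_gt0.
  have key : s * m i / (2 * M) * expR (q * - L) <= C * expR (- L + 2^-1).
    apply: le_trans (le_trans lower upper).
    have -> : s * m i / (2 * M) * expR (q * - L) =
      s * m i * expR (q * - L) / M * 2^-1 by field; rewrite gt_eqF.
    apply: ler_pM => //.
    - by rewrite divr_ge0 ?(ltW M0) // mulr_ge0 ?expR_ge0 // ltW.
    - rewrite [leRHS]mulrA [s * (_ * _)]mulrA ler_pM2l ?lef_pV2 ?posrE //.
      by rewrite mulr_gt0 ?expR_gt0.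
  have : expR ((1 - q) * L) <= b i.
    rewrite /b ler_pdivlMr //.
    have -> : (1 - q) * L = q * - L + L by ring.
    rewrite expRD.
    have := ler_wpM2r (expR_ge0 L) key; rewrite expRD expRN.
    have -> : C * ((expR L)^-1 * expR 2^-1) * expR L = C * expR 2^-1.
      by field; rewrite gt_eqF ?expR_gt0.
    rewrite -(ler_pM2l (_ : 0 < 2 * M)) ?mulr_gt0 // => h; apply: le_trans h.
    by rewrite le_eqVlt; apply/orP; left; apply/eqP; field; rewrite gt_eqF.
  have bi : b i <= \sum_i b i.
    by rewrite (bigD1 i) //= lerDl; apply: sumr_ge0 => k _; exact: ltW.
  have -> : (1 - q) * L = \sum_i b i + 1 by rewrite /L; field; rewrite gt_eqF.
  have := expR_ge1Dx (\sum_i b i + 1); move: bi; lra.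
pose d := \big[Num.min/1]_i (x 0 i + L).
have d0 : 0 < d by apply/lt_bigmin => // i _; have := xL i; lra.
have dL i : d <= x 0 i + L by exact: bigmin_le_cond.
exists x, d; split => // i t t0 td.
(* The raised point may leave the box through the face at 0; subtracting [t] everywhere brings it
   back, and [t <= d] keeps the other coordinates above [- L]. *)
rewrite -(objective_shift u_span m_gt0 q01 N_gt0 (x + t *: e_ i) (- t)).
apply: xmin => k; rewrite mxE step_coord mxE.
have := dL k; have /andP[h1 h2] := xb k.
by case: eqP => _ ?; rewrite ?mulr1 ?mulr0 ?addr0; apply/andP; split; lra.
Qed.

End MinimiserExists.

(** * Passage to the limit and solution of the discrete equation *)

Section VertexWeights.
Context {R : realType} {n N : nat}.
Variable u : 'I_N -> 'rV[R]_n.+1.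
Hypothesis u_unit : forall i, enorm (u i) = 1.
Hypothesis u_span : forall v, (forall i, dot v (u i) = 0) -> v = 0.
Hypothesis u_indep : forall i j, i != j -> u i != u j /\ u i != - u j.
Implicit Types (x y : 'rV[R]_N) (i j : 'I_N) (t : R).
Local Notation sigma := (@sphere_measure R n).
Local Notation s := (mass (setT : set 'rV[R]_n.+1)).
Local Notation e_ i := (delta_mx 0 i : 'rV[R]_N).

Let step_coord x i t j : (x + t *: e_ i) 0 j = x 0 j + t * (j == i)%:R.
Proof. by rewrite !mxE eqxx. Qed.

Lemma cell_step_mono x i t t' : t <= t' ->
  cell u (x + t *: e_ i) i `<=` cell u (x + t' *: e_ i) i.
Proof.
move=> tt' v vt j; have := vt j; rewrite !step_coord eqxx !mulr1.
have [->|ji] := eqVneq j i; first by rewrite !mulr1.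
rewrite !mulr0 !addr0 => /le_trans; apply.
by rewrite ler_wpM2r // ler_expR lerD2l.
Qed.

(** If [v] violated the j-th condition at [x], the ratio [b / a] would exceed 1, hence also exp (1 /
    (k + 1)) for some k, and [v] would miss that cell. *)
Lemma bigcap_cell x i :
  \bigcap_k cell u (x + k.+1%:R^-1 *: e_ i) i = cell u x i.
Proof.
apply/seteqP; split => v; last first.
  move=> vi k _; apply: (@cell_step_mono x i 0); first by rewrite invr_ge0.
  by rewrite scale0r addr0.
move=> h j; have [->//|ji] := eqVneq j i.
rewrite leNgt; apply/negP; set a := _ * `|dot v (u i)|; set b := _ * _ => ab.
have {}h k : b <= expR k.+1%:R^-1 * a.
  have := h k Logic.I j; rewrite !step_coord eqxx (negbTE ji) mulr1 mulr0 addr0 expRD.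
  by rewrite mulrAC [leRHS]mulrC.
have a_ge0 : 0 <= a by rewrite mulr_ge0 ?expR_ge0.
have a0 : 0 < a.
  rewrite lt_neqAle a_ge0 andbT eq_sym; apply/eqP => a0.
  by have := lt_le_trans ab (h 0%N); rewrite a0 mulr0 ltxx.
have b0 : 0 < b := lt_trans a0 ab.
have l0 : 0 < ln (b / a) by rewrite ln_gt0 // ltr_pdivlMr // mul1r.
have [K _ /(_ K (leqnn K)) hK] := near_infty_natSinv_lt (PosNum l0).
have := h K; rewrite leNgt -ltr_pdivlMr //; apply/negP; rewrite negbK.
by rewrite -[ltRHS](@lnK _ (b / a)) ?posrE ?divr_gt0 // ltr_expR.
Qed.

(** Continuity from above of the finite measure along the decreasing cells at steps 1 / (k + 1). *)
Lemma cell_mass_lim x i (b d : R) : 0 < d ->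
  (forall t, 0 < t -> t <= d -> b <= mass (cell u (x + t *: e_ i) i)) ->
  b <= mass (cell u x i).
Proof.
move=> d0 h; rewrite -lee_fin massE -bigcap_cell.
pose F k := cell u (x + k.+1%:R^-1 *: e_ i) i.
pose om : {outer_measure set 'rV[R]_n.+1 -> \bar R} := sigma.
pose mu : {measure set (caratheodory_type om) -> \bar R} := om.
have cF : mu \o F @ \oo --> mu (\bigcap_k F k).
  apply: nonincreasing_cvg_mu.
  - exact: sphere_measure_lty.
  - by move=> k; exact: cell_caratheodory.
  - by rewrite bigcap_cell; exact: cell_caratheodory.
  - move=> k l kl; apply/subsetPset; apply: cell_step_mono.
    by rewrite lef_pV2 ?posrE // ler_nat.
rewrite -[X in (_ <= X)%E](cvg_lim _ cF) //; apply: lime_ge.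
  by apply/cvg_ex; exists (mu (\bigcap_k F k)).
have := near_infty_natSinv_lt (PosNum d0); apply: filterS => k /= kd.
by rewrite -massE lee_fin; apply: h; rewrite ?invr_gt0 // ltW.
Qed.

Lemma exists_vertex_weights (m : 'I_N -> R) (q : R) :
  (forall i, 0 < m i) -> 0 < q < 1 ->
  exists x, forall i b,
    mass (normal_cone (vertex u x) (i, b)) = m i * expR (q * x 0 i).
Proof.
move=> m0 q01; have [N0|N0] := posnP N.
  by exists 0 => i; have := ltn_ord i; rewrite {2}N0.
have /andP[q0 q1] := q01; have s0 : 0 < s := massT_gt0.
have [x [d [d0 xmin]]] := interior_minimiser u_unit u_span m0 q01 N0.
have Z0 := weight_sum_gt0 q m0 N0 x; set Z := weight_sum m q x in Z0.
pose a i := m i * expR (q * x 0 i) / Z.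
have a0 i : 0 < a i by rewrite divr_gt0 // mulr_gt0 // expR_gt0.
have cell_ge i : s * a i <= mass (cell u x i).
  apply/ler_addgt0Pr => e e0; rewrite -lerBlDr.
  have sa0 : 0 < s * a i * q by apply: mulr_gt0 => //; apply: mulr_gt0.
  (* The second bound keeps the loss [s * a i * (q * t)] of [cell_mass_ge] below [e]. *)
  apply: (@cell_mass_lim x i _ (Num.min d (e / (s * a i * q)))).
    by rewrite lt_min d0 divr_gt0.
  move=> t t0; rewrite le_min => /andP[td te].
  apply: le_trans (cell_mass_ge u_span m0 q01 N0 t0 (xmin i t t0 td)).
  rewrite -/Z -/(a i) mulrBr mulr1 lerB // mulrA.
  by rewrite mulrC -ler_pdivlMr.
have sum_a : \sum_i s * a i = s.
  by rewrite -mulr_sumr -mulr_suml -/(weight_sum m q x) -/Z divff ?mulr1 // gt_eqF.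
have cell_eq i : mass (cell u x i) = s * a i.
  apply/eqP; rewrite -subr_eq0; apply/eqP.
  have le0 : \sum_i (mass (cell u x i) - s * a i) <= 0.
    by rewrite sumrB subr_le0 sum_a; exact: sum_cell_mass.
  have ge0 j : xpredT j -> 0 <= mass (cell u x j) - s * a j by rewrite subr_ge0.
  have sum0 : \sum_i (mass (cell u x i) - s * a i) = 0.
    by apply/eqP; rewrite eq_le le0 /= sumr_ge0.
  have all0 := psumr_eq0P ge0 sum0.
  exact: all0.
(* Each normal cone has mass s a_i / 2, that is s / (2 Z) times m_i exp (q x_i). A shift leaves the
   cells fixed, so shifting by [tau] puts that factor into the exponential. *)
pose tau := ln (s / (2 * Z)) / q.
have tauE : expR (q * tau) = s / (2 * Z).
  by rewrite /tau mulrCA divff ?gt_eqF // mulr1 lnK // posrE divr_gt0 // mulr_gt0.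
exists (x + const_mx tau) => i b.
have -> : mass (normal_cone (vertex u (x + const_mx tau)) (i, b)) =
    mass (cell u (x + const_mx tau) i) / 2.
  rewrite cell_mass // mulrAC mulfV ?mul1r // /mass.
  by congr fine; exact: normal_cone_vertex_mass.
rewrite cell_shift cell_eq !mxE mulrDr expRD tauE /a.
by field; rewrite gt_eqF.
Qed.

End VertexWeights.

(** * Support and radial functions, symmetric polytopes *)

Section Bodies.
Context {R : realType} {n : nat}.
Implicit Types (u v : sphere R n) (x y : 'rV[R]_n.+1).

Lemma enorm_sphere u : enorm (\val u) = 1.
Proof. exact: (set_mem (valP u)). Qed.

Lemma dot_sphere u : dot (\val u) (\val u) = 1.
Proof. by rewrite -sqr_enorm enorm_sphere expr1n. Qed.

Lemma sphere_val_inj : injective (\val : sphere R n -> 'rV[R]_n.+1).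
Proof. exact: val_inj. Qed.

Definition to_sphere x (x1 : enorm x = 1) : sphere R n := SigSub (mem_set x1).

Variable K : set 'rV[R]_n.+1.
Hypothesis bodyK : convex_body_o K.

Lemma body_compact : compact K. Proof. by case: bodyK => -[]. Qed.

Lemma body_closed : closed K.
Proof. exact: compact_closed (@norm_hausdorff _ _) body_compact. Qed.

Lemma body_bounded : exists2 M : R, 0 < M & forall x, K x -> enorm x <= M.
Proof.
have [M [_ KM]] := compact_bounded body_compact.
exists (n.+1%:R * (`|M| + 1)); first by rewrite mulr_gt0 // ltr_wpDl.
move=> x Kx; apply: le_trans (enorm_le_norm x) _; rewrite ler_pM2l //.
by apply: KM Kx; rewrite (le_lt_trans (ler_norm M)) // ltrDl.
Qed.

Lemma body_ball : exists2 r : R, 0 < r & forall x, enorm x < r -> K x.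
Proof.
have [_ /nbhs_normP[r /= r0 rK]] := bodyK; exists r => // x xr.
by apply: rK; rewrite /= sub0r normrN (le_lt_trans (norm_le_enorm x)).
Qed.

(** The supremum is attained since the admissible multiples form a closed bounded set, and it is
    positive since [K] contains a ball around 0. *)
Lemma radial_funP u :
  [/\ 0 < radial_fun K u, K (radial_fun K u *: \val u)
    & forall l : R, K (l *: \val u) -> l <= radial_fun K u].
Proof.
pose A := [set l : R | K (l *: \val u)].
have [M M0 KM] := body_bounded; have [r r0 rK] := body_ball.
have AM : ubound A M.
  move=> l /KM; rewrite enormZ enorm_sphere mulr1; exact/le_trans/ler_norm.
have r2 : 0 < r / 2 by rewrite divr_gt0.
have Ar : A (r / 2).
  by apply: rK; rewrite enormZ enorm_sphere mulr1 gtr0_norm // gtr_pMr // invf_lt1 // ltr1n.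
have ub l : A l -> l <= sup A by apply: ub_le_sup; exists M.
split; first exact: lt_le_trans r2 (ub _ Ar).
- have cA : closed A.
    apply: (@preimage_closed _ _ (fun l : R => l *: \val u) K _ body_closed).
    move=> l _; apply: (@lipschitz_continuous _ R^o _ _ `|\val u|) => a b.
    by rewrite -scalerBl normrZ mulrC.
  by apply: (cA (sup A)); apply: closure_sup; [exists (r / 2)|exists M].
- exact: ub.
Qed.

Lemma support_funP v : exists x, [/\ K x, dot x (\val v) = support_fun K v
  & forall y, K y -> dot y (\val v) <= support_fun K v].
Proof.
have [r r0 rK] := body_ball.
have K0 : K !=set0 by exists 0; apply: rK; rewrite /enorm dot0l sqrtr0.
have [x /set_mem Kx xmax] : exists2 c, c \in K & forall t, t \in K -> dot t (\val v) <= dot c (\val v).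
  apply: (EVT_max_rV K0 body_compact (f := fun x => dot x (\val v))).
  by apply: continuous_subspaceT; exact: continuous_dotl.
pose A := [set dot x (\val v) | x in K].
have AM : ubound A (dot x (\val v)).
  by move=> _ [y Ky <-]; apply: xmax; exact: mem_set.
have ub y : K y -> dot y (\val v) <= support_fun K v.
  by move=> Ky; apply: ub_le_sup; [exists (dot x (\val v))|exists y].
exists x; split => //; apply/eqP; rewrite eq_le ub //=.
by apply: ge_sup => //; exists (dot x (\val v)), x.
Qed.

Lemma support_fun_ge x v : K x -> dot x (\val v) <= support_fun K v.
Proof. by have [y [_ _]] := support_funP v; exact. Qed.

Lemma support_fun_gt0 v : 0 < support_fun K v.
Proof.
have [r r0 rK] := body_ball; have r2 : 0 < r / 2 by rewrite divr_gt0.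
apply: (@lt_le_trans _ _ (dot (r / 2 *: \val v) (\val v))).
  by rewrite dotZl dot_sphere mulr1.
apply: support_fun_ge; apply: rK.
by rewrite enormZ enorm_sphere mulr1 gtr0_norm // gtr_pMr // invf_lt1 // ltr1n.
Qed.

(** A larger multiple of [x] in [K] would exceed the support value, which is positive; so [x] is the
    radial point in its direction. *)
Lemma contact_radial x v : K x -> dot x (\val v) = support_fun K v ->
  exists u, radial_fun K u *: \val u = x.
Proof.
move=> Kx xv; have h0 := support_fun_gt0 v.
have x0 : x != 0 by apply: contraTneq h0 => x0; rewrite -xv x0 dot0l ltxx.
have nx0 : 0 < enorm x by rewrite enorm_gt0.
have u1 : enorm ((enorm x)^-1 *: x) = 1.
  by rewrite enormZ ger0_norm ?invr_ge0 ?enorm_ge0 // mulVf // gt_eqF.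
exists (to_sphere u1); have [rho0 Krho rho_ge] := radial_funP (to_sphere u1).
suff -> : radial_fun K (to_sphere u1) = enorm x.
  by rewrite /= scalerA mulfV ?scale1r // gt_eqF.
apply/eqP; rewrite eq_le; apply/andP; split; last first.
  by apply: rho_ge; rewrite /= scalerA mulfV ?scale1r // gt_eqF.
have := support_fun_ge v Krho; rewrite /= scalerA dotZl xv.
by rewrite -ler_pdivlMr // divff ?gt_eqF // ler_pdivrMr // mul1r.
Qed.

End Bodies.

(** * Symmetric polytopes as linear images of the cross-polytope *)

Section CrossHull.
Context {R : realType} {n N : nat}.
Variable p : 'I_N -> 'rV[R]_n.+1.
Implicit Types (t : 'rV[R]_N).

Definition cross_comb t : 'rV[R]_n.+1 := \sum_i t 0 i *: p i.

(** Parametrising the hull of the points +-p_i by the unit ball of the l1 norm passes compactness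
    and symmetry on from that ball. *)
Definition cross_hull : set 'rV[R]_n.+1 :=
  [set cross_comb t | t in [set t : 'rV[R]_N | \sum_i `|t 0 i| <= 1]].

Lemma cross_hull_vertex (b : bool) i : cross_hull ((-1) ^+ b *: p i).
Proof.
exists ((-1) ^+ b *: delta_mx 0 i).
  rewrite /= (bigD1 i) //= big1 => [|j /negbTE ji]; rewrite !mxE ?ji ?andbF ?mulr0 ?normr0 //.
  by rewrite !eqxx mulr1 addr0 normrX normrN1 expr1n.
rewrite /cross_comb (bigD1 i) //= big1 => [|j /negbTE ji].
  by rewrite !mxE !eqxx mulr1 addr0.
by rewrite !mxE ji andbF mulr0 scale0r.
Qed.

Lemma cross_hullN : cross_hull = -%R @` cross_hull.
Proof.
have opp x : cross_hull x -> cross_hull (- x).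
  move=> [t t1 <-]; exists (- t).
    by rewrite /= (eq_bigr (fun i => `|t 0 i|)) // => i _; rewrite mxE normrN.
  by rewrite /cross_comb -sumrN; apply: eq_bigr => i _; rewrite mxE scaleNr.
apply/seteqP; split => [x Kx|_ [x Kx <-]]; last exact: opp.
by exists (- x); [exact: opp|rewrite opprK].
Qed.

Lemma cross_hull_convex : convex_set cross_hull.
Proof.
move=> _ _ l /set_mem [t t1 <-] /set_mem [t' t1' <-]; apply/mem_set.
have l0 : 0 <= l%:num by []. have l1 : l%:num <= 1 by [].
exists (l%:num *: t + (1 - l%:num) *: t').
  apply: (@le_trans _ _ (\sum_i (l%:num * `|t 0 i| + (1 - l%:num) * `|t' 0 i|))).
    apply: ler_sum => i _; rewrite !mxE; apply: le_trans (ler_normD _ _) _.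
    by rewrite !normrM (ger0_norm l0) (@ger0_norm _ (1 - l%:num)) ?subr_ge0.
  rewrite big_split -!mulr_sumr /=.
  have h1 := ler_wpM2l l0 t1; have h2 : (1 - l%:num) * \sum_i `|t' 0 i| <= 1 - l%:num.
    by rewrite ler_piMr // subr_ge0.
  by move: h1 => /= h1; lra.
rewrite /cross_comb /conv /= !scaler_sumr -big_split; apply: eq_bigr => i _.
by rewrite !mxE scalerDl !scalerA.
Qed.

Lemma cross_comb_continuous : continuous cross_comb.
Proof.
apply: (@lipschitz_continuous _ _ _ _ (\sum_i `|p i|)) => t t'.
have -> : cross_comb t - cross_comb t' = \sum_i (t - t') 0 i *: p i.
  by rewrite -sumrB; apply: eq_bigr => i _; rewrite !mxE scalerBl.
apply: le_trans (ler_norm_sum _ _ _) _; rewrite mulr_suml; apply: ler_sum => i _.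
by rewrite normrZ mulrC ler_wpM2l // coord_le_norm.
Qed.

Lemma cross_hull_compact : compact cross_hull.
Proof.
apply: continuous_compact; first by apply: continuous_subspaceT; exact: cross_comb_continuous.
apply: bounded_closed_compact.
  exists 1; split => // M M1 t t1; apply: le_trans (ltW M1).
  rewrite [leLHS]/Num.norm /= mx_normrE; apply/bigmax_leP; split => // -[i j] _ /=.
  rewrite ord1; apply: le_trans t1; rewrite (bigD1 j) //= lerDl.
  by apply: sumr_ge0.
apply: (@preimage_closed _ _ (fun t => \sum_i `|t 0 i|) [set r : R | r <= 1]).
  move=> t _; apply: (@lipschitz_continuous _ _ R^o _ N%:R) => a b.
  rewrite -sumrB; apply: le_trans (ler_norm_sum _ _ _) _.
  have -> : N%:R * `|a - b| = \sum_(i < N) `|a - b|.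
    by rewrite sumr_const card_ord mulr_natl.
  apply: ler_sum => i _; apply: le_trans (ler_dist_dist _ _) _.
  by have := coord_le_norm (a - b) i; rewrite !mxE.
exact: closed_le.
Qed.

(** The points are added one at a time with relative weight w_i / d, the rest having total weight d
    - w_i; any slack in the weights goes to the point 0. *)
Lemma convex_sub_comb (C : set 'rV[R]_n.+1) (c : 'I_N -> 'rV[R]_n.+1)
    (w : 'I_N -> R) (r : seq 'I_N) (d : R) :
  convex_set C -> C 0 -> (forall i, C (c i)) -> (forall i, 0 <= w i) ->
  \sum_(i <- r) w i <= d ->
  exists2 x, C x & \sum_(i <- r) w i *: c i = d *: x.
Proof.
move=> Cc C0 Ccs w0; elim: r d => [|i r IH] d.
  by rewrite !big_nil => d0; exists 0 => //; rewrite scaler0.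
rewrite !big_cons => wd.
have ws0 : 0 <= \sum_(j <- r) w j by apply: sumr_ge0.
have [|x Cx ->] := IH (d - w i); first by lra.
have wi := w0 i.
have [d0|d0] := eqVneq d 0.
  have wi0 : w i = 0 by lra.
  by exists 0 => //; rewrite wi0 d0 subr0 !scale0r addr0.
have d_gt0 : 0 < d by rewrite lt_neqAle eq_sym d0; lra.
have l0 : 0 <= w i / d by rewrite divr_ge0 // ltW.
have l1 : w i / d <= 1 by rewrite ler_pdivrMr // mul1r; lra.
have := Cc (c i) x (Itv01 l0 l1) (mem_set (Ccs i)) (mem_set Cx) => /set_mem Cy.
eexists; first exact: Cy.
rewrite /conv /= scalerDr !scalerA mulrCA mulfV // mulr1.
by congr (_ + _ *: _); change (d - w i = d * (1 - w i / d)); field.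
Qed.

Lemma cross_hullE : (0 < N)%N -> cross_hull =
  convex_hull (range (fun a : 'I_N * bool => (-1) ^+ a.2 *: p a.1)).
Proof.
move=> N0; apply/seteqP; split => [_ [t t1 <-] C [Cc AC]|x hx]; last first.
  apply: hx; split; first exact: cross_hull_convex.
  by move=> _ [[i b] _ <-]; exact: cross_hull_vertex.
have Cv (b : bool) i : C ((-1) ^+ b *: p i) by apply: AC; exists (i, b).
(* 0 is the midpoint of an opposite pair of vertices. *)
have C0 : C 0.
  pose i0 := Ordinal N0.
  have h0 : 0 <= 2^-1 :> R by rewrite invr_ge0.
  have h1 : 2^-1 <= 1 :> R by rewrite invf_le1 // ler1n.
  have := Cc _ _ (Itv01 h0 h1) (mem_set (Cv false i0)) (mem_set (Cv true i0)).
  move=> /set_mem; rewrite /conv /= expr0 expr1 scaleN1r scale1r scalerN -scalerBl.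
  rewrite (_ : _ - _ = 0) ?scale0r //.
  by change (2^-1 - (1 - 2^-1) = 0 :> R); lra.
have [x Cx xE] := @convex_sub_comb C (fun i => (-1) ^+ (t 0%R i < 0)%R *: p i)
  (fun i => `|t 0 i|) (index_enum _) 1 Cc C0 (fun i => Cv _ i) (fun i => normr_ge0 _) t1.
rewrite scale1r in xE; rewrite /cross_comb (_ : \sum_i _ = x) // -xE.
by apply: eq_bigr => i _; rewrite scalerA mulrC -realEsign // num_real.
Qed.

Lemma cross_hull_polytope : (0 < N)%N -> polytope cross_hull.
Proof.
move=> N0; exists (range (fun a : 'I_N * bool => (-1) ^+ a.2 *: p a.1)).
  exact: finite_image.
exact: cross_hullE.
Qed.

Hypothesis p_span : forall v, (forall i, dot v (p i) = 0) -> v = 0.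

(** The matrix [B] with rows p_i has a left inverse [D], so x = (x D) B, and the coefficients x D
    have l1 norm at most 1 for small x. *)
Lemma cross_hull_nbhs0 : nbhs (0 : 'rV[R]_n.+1) cross_hull.
Proof.
pose B : 'M[R]_(N, n.+1) := \matrix_(i, j) p i 0 j.
have /row_fullP[D DB] : row_full B.
  rewrite /row_full -mxrank_tr -/(row_free _) -kermx_eq0; apply/eqP/row_matrixP => k.
  rewrite row0; apply: p_span => i.
  have /rowP/(_ i) : row k (kermx B^T) *m B^T = 0 by rewrite -row_mul mulmx_ker row0.
  rewrite !mxE => h; rewrite -[RHS]h; apply: eq_bigr => j _.
  by rewrite !mxE.
pose C := \sum_(j < N) \sum_(i < n.+1) `|D i j|.
have C0 : 0 <= C by apply: sumr_ge0 => j _; apply: sumr_ge0.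
have C1 : 0 < C + 1 by rewrite ltr_wpDl.
apply/(@nbhs_normP R 'rV[R]_n.+1); exists (C + 1)^-1; first by rewrite /= invr_gt0.
move=> x /=; rewrite sub0r normrN => xC; exists (x *m D).
  apply: (@le_trans _ _ (`|x| * C)).
    rewrite mulr_sumr; apply: ler_sum => j _; rewrite mxE mulr_sumr.
    apply: le_trans (ler_norm_sum _ _ _) _; apply: ler_sum => i _.
    by rewrite normrM ler_wpM2r // coord_le_norm.
  apply: (@le_trans _ _ (`|x| * (C + 1))); first by rewrite ler_wpM2l // lerDl.
  by rewrite -ler_pdivlMr // div1r ltW.
rewrite -[RHS]mulmx1 -DB mulmxA /cross_comb; apply/rowP => j.
rewrite summxE [in RHS]mxE; apply: eq_bigr => i _.
by rewrite !mxE.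
Qed.

Lemma cross_hull_body : (0 < N)%N -> convex_body_e cross_hull.
Proof.
move=> N0; split; last exact: cross_hullN.
have int0 : cross_hull° 0 by exact: cross_hull_nbhs0.
split => //; split; [exact: cross_hull_compact|exact: cross_hull_convex|by exists 0].
Qed.

End CrossHull.

(** * Radial Gauss image and integral curvature of the polytope *)

Section CurvatureCrossHull.
Context {R : realType} {n N : nat}.
Variable U : 'I_N -> sphere R n.
Let u i := \val (U i).
Hypothesis N_gt0 : (0 < N)%N.
Hypothesis u_span : forall v, (forall i, dot v (u i) = 0) -> v = 0.
Hypothesis u_indep : forall i j, i != j -> u i != u j /\ u i != - u j.
Variable x : 'rV[R]_N.
Let w := vertex u x.
Hypothesis cone_gt0 : forall a, (0 < sphere_measure (normal_cone w a))%E.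
Let p i := expR (x 0 i) *: u i.
Let K := cross_hull p.
Local Notation S := (unit_sphere (R := R) (n := n)).
Local Notation sigma := (@sphere_measure R n).
Implicit Types (a b : 'I_N * bool) (v : sphere R n).

Let u_unit i : enorm (u i) = 1. Proof. exact: enorm_sphere. Qed.

Lemma direction_unit a : enorm ((-1) ^+ a.2 *: u a.1) = 1.
Proof. by rewrite enormZ u_unit mulr1 normrX normrN1 expr1n. Qed.

Definition direction a : sphere R n := to_sphere (direction_unit a).

Lemma vertexE a : w a = expR (x 0 a.1) *: \val (direction a).
Proof. by rewrite /w /vertex /= scalerA mulrC. Qed.

Lemma vertex_cross a : w a = (-1) ^+ a.2 *: p a.1.
Proof. by rewrite /w /vertex scalerA. Qed.

Lemma p_span (v : 'rV[R]_n.+1) : (forall i, dot v (p i) = 0) -> v = 0.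
Proof.
move=> h; apply: u_span => i; have := h i; rewrite dotZr => /eqP.
by rewrite mulf_eq0 gt_eqF ?expR_gt0 //= => /eqP.
Qed.

Let bodyK : convex_body_o K. Proof. by have [] := cross_hull_body p_span N_gt0. Qed.

Lemma normal_cone_ex (v : 'rV[R]_n.+1) : exists a, normal_cone w a v.
Proof.
pose a := [arg max_(a > (Ordinal N_gt0, true)) dot v (w a)]%O.
by exists a => b; rewrite /a; case: arg_maxP => // c _; exact.
Qed.

Lemma normal_cone_abs a (v : 'rV[R]_n.+1) i :
  normal_cone w a v -> `|dot v (p i)| <= dot v (w a).
Proof.
move=> va; rewrite ler_norml; have := va (i, false); have := va (i, true).
by rewrite !(vertex_cross (_, _)) /= expr0 expr1 scaleN1r scale1r dotNr => ? ?; apply/andP; split; lra.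
Qed.

Lemma vertex_in a : K (w a).
Proof. by rewrite vertex_cross; exact: cross_hull_vertex. Qed.

Lemma support_cross a v : normal_cone w a (\val v) ->
  support_fun K v = dot (\val v) (w a).
Proof.
move=> va; have [y [Ky yv ymax]] := support_funP bodyK v.
apply/eqP; rewrite eq_le; apply/andP; split; last first.
  by rewrite dotC; apply: ymax; exact: vertex_in.
rewrite -yv; case: Ky => t t1 <-; rewrite /cross_comb dotC dot_sumr.
have M0 : 0 <= dot (\val v) (w a).
  by apply: le_trans (normal_cone_abs (Ordinal N_gt0) va).
apply: (@le_trans _ _ (\sum_i `|t 0 i| * dot (\val v) (w a))); last first.
  by rewrite -mulr_suml ler_piMl.
apply: ler_sum => i _; rewrite dotZr (le_trans (ler_norm _)) // normrM.
by rewrite ler_wpM2l //; exact: normal_cone_abs.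
Qed.

(** A normal cone of positive measure contains a unit vector, whose supporting hyperplane at [w a]
    excludes larger multiples. *)
Lemma radial_direction a : radial_fun K (direction a) = expR (x 0 a.1).
Proof.
have [rho0 Krho rho_ge] := radial_funP bodyK (direction a).
apply/eqP; rewrite eq_le; apply/andP; split; last first.
  by apply: rho_ge; rewrite -vertexE; exact: vertex_in.
have [v0 [va vS]] : (normal_cone w a `&` S) !=set0.
  apply/set0P/negP => /eqP e; have := cone_gt0 a.
  by rewrite /sphere_measure e hausdorff_set0 ltxx.
pose v := to_sphere vS.
have h := support_fun_ge bodyK v Krho; have h0 := support_fun_gt0 bodyK v.
move: h h0; rewrite (@support_cross a v va) (dotC (\val v)) vertexE !dotZl.
move=> h; rewrite pmulr_rgt0 ?expR_gt0 // => h0.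
by rewrite ler_pM2r in h.
Qed.

Lemma Gauss_image_sub a (A : set (sphere R n)) v :
  A (direction a) -> normal_cone w a (\val v) -> radial_Gauss_image K A v.
Proof.
move=> Aa va; exists (direction a) => //.
by rewrite radial_direction (support_cross va) vertexE dotZr mulrC.
Qed.

(** If [v] lies in just one cone, the contact point must be its vertex: equality in sum_i t_i (v .
    p_i) <= M forces every other coefficient t_i to vanish. *)
Lemma Gauss_image_cone (A : set (sphere R n)) v : radial_Gauss_image K A v ->
  (exists2 a, A (direction a) & normal_cone w a (\val v)) \/
  (exists a b, [/\ a != b, normal_cone w a (\val v) & normal_cone w b (\val v)]).
Proof.
move=> [u' Au' u'v]; have [a va] := normal_cone_ex (\val v).
have [|uniq_a] := pselect (exists2 b, a != b & normal_cone w b (\val v)).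
  by case=> b ab vb; right; exists a, b.
left; exists a => //.
have [rho0 [t /= t1 tE] _] := radial_funP bodyK u'.
have hv := support_cross va; have h0 := support_fun_gt0 bodyK v.
set M := dot (\val v) (w a) in hv; rewrite hv in h0 u'v.
pose d i := dot (\val v) (p i).
have d_le i : `|d i| <= M by exact: normal_cone_abs.
have d_lt i : i != a.1 -> `|d i| < M.
  move=> ia; rewrite lt_neqAle d_le andbT; apply/eqP => di; apply: uniq_a.
  (* The sign of [d i] selects which of +-p_i would attain the maximum too. *)
  exists (i, d i < 0); first by apply: contra ia => /eqP ->.
  move=> c; rewrite [leRHS](_ : _ = M); first exact: va.
  by rewrite vertex_cross /= dotZr -di -/(d i) normrEsign ?num_real.
have sumtd : \sum_i t 0 i * d i = M.
  rewrite -u'v mulrC -dotZr -tE /cross_comb dot_sumr.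
  by apply: eq_bigr => i _; rewrite dotZr.
have ge0 i : xpredT i -> 0 <= `|t 0 i| * M - t 0 i * d i.
  move=> _; rewrite subr_ge0 (le_trans (ler_norm _)) // normrM.
  by rewrite ler_wpM2l.
have sum0 : \sum_i (`|t 0 i| * M - t 0 i * d i) = 0.
  apply/eqP; rewrite eq_le sumr_ge0 // andbT sumrB sumtd -mulr_suml subr_le0.
  by rewrite ler_piMl // ltW.
have all0 := psumr_eq0P ge0 sum0.
have tj0 j : j != a.1 -> t 0 j = 0.
  move=> ja; have := all0 j isT; have := d_lt j ja.
  have := ler_norm (t 0 j * d j); rewrite normrM => h1 h2 h3.
  have h4 : `|t 0 j| * (M - `|d j|) <= 0 by rewrite mulrBr; lra.
  apply/eqP; rewrite -normr_le0 -(@pmulr_lle0 _ (M - `|d j|)) ?subr_gt0 //.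
have yE : radial_fun K u' *: \val u' = t 0 a.1 *: p a.1.
  rewrite -tE /cross_comb (bigD1 a.1) //= big1 ?addr0 // => j /tj0 ->.
  by rewrite scale0r.
have td : t 0 a.1 * d a.1 = M.
  rewrite -sumtd (bigD1 a.1) //= big1 ?addr0 // => j /tj0 ->.
  by rewrite mul0r.
have Md : M = (-1) ^+ a.2 * d a.1 by rewrite /M vertex_cross dotZr.
have d0 : d a.1 != 0.
  by apply: contraTneq h0 => d0; rewrite Md d0 mulr0 ltxx.
have tE' : t 0 a.1 = (-1) ^+ a.2 by apply: (mulIf d0); rewrite td.
have yw : radial_fun K u' *: \val u' = expR (x 0 a.1) *: \val (direction a).
  by rewrite yE tE' -vertex_cross vertexE.
have rhoE : radial_fun K u' = expR (x 0 a.1).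
  have := congr1 (@enorm R _) yw; rewrite (enormZ (radial_fun K u')) (enormZ (expR _)) !enorm_sphere !mulr1.
  by rewrite !ger0_norm ?expR_ge0 ?(ltW rho0).
suff -> : direction a = u' by [].
apply: sphere_val_inj; apply: (@scalerI _ _ (expR (x 0 a.1))).
  by rewrite gt_eqF ?expR_gt0.
by rewrite -yw rhoE.
Qed.

(* A normal vector touching [K] away from a single vertex lies in two of the
   normal cones, hence in one of finitely many null great subspheres. *)
Lemma integral_curvature_cross (A : set (borel_sphere R n)) :
  integral_curvature K A =
  (\sum_(a | `[< A (direction a) >]) sigma (normal_cone w a))%E.
Proof.
rewrite -(sphere_measure_normal_cones _ (@vertex_inj _ _ _ _ u_unit u_indep x)).
set C := \big[setU/set0]_(a | _) _.
have CE (v : 'rV[R]_n.+1) : C v <-> exists2 a, A (direction a) & normal_cone w a v.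
  rewrite /C -bigcup_seq_cond; split=> [[a /= /andP[_ /asboolP Aa] va]|[a Aa va]].
    by exists a.
  by exists a => //=; rewrite mem_index_enum; apply/asboolP.
apply/eqP; rewrite eq_le; apply/andP; split.
  pose E (ab : ('I_N * bool) * ('I_N * bool)) : set 'rV[R]_n.+1 :=
    if ab.1 != ab.2 then normal_cone w ab.1 `&` normal_cone w ab.2 else set0.
  apply: (@le_trans _ _ (sigma (C `|` \bigcup_ab E ab))).
    apply: le_hausdorff => _ [v /Gauss_image_cone va <-]; split; last exact: enorm_sphere.
    case: va => [[a Aa va]|[a [b [ab va vb]]]]; first by left; apply/CE; exists a.
    by right; exists (a, b) => //; rewrite /E /= ab.
  apply: le_trans (outer_measureU2 sigma _ _) _.
  rewrite -[leRHS]adde0 leeD2l //.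
  apply: le_trans (@outer_measure_fincover _ _ sigma _ _ E (@subset_refl _ _)) _.
  rewrite big1 // => -[a b] _; rewrite /E /=; case: ifPn => [ab|_].
    by apply: sphere_measure_normal_coneI ab; exact: vertex_inj.
  exact: outer_measure0.
apply: le_hausdorff => v [/CE[a Aa va] vS].
by exists (to_sphere vS) => //; exact: (@Gauss_image_sub a A (to_sphere vS) Aa va).
Qed.

End CurvatureCrossHull.

(** * Integrals against set functions *)

Section Integrals.
Context {d : measure_display} {T : measurableType d} {R : realType}.
Import HBNNSimple.
Local Open Scope ereal_scope.

(* [J] is an arbitrary set function, so the integral is only compared with that
   of the single simple function [c \1_D]. *)
Lemma integral_ge_cst (J : set T -> \bar R) (D : set T) (f : T -> R) (c : R) :
  J set0 = 0 -> measurable D -> (0 < c)%R -> (forall t, D t -> c <= f t)%R ->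
  c%:E * J D <= \int[J]_(t in D) (f t)%:E.
Proof.
move=> J0 mD c0 cf; pose g := ((fun t => (f t)%:E) \_ D).
have f0 t : D t -> 0 <= (f t)%:E.
  by move=> Dt; rewrite lee_fin (le_trans (ltW c0)) // cf.
have g0 t : setT t -> 0 <= g t.
  by move=> _; rewrite /g patchE; case: ifPn => // /set_mem; exact: f0.
have gE : g^\+ = g by apply/funext => t; rewrite (ge0_funeposE g0) // inE.
have gN : g^\- = cst 0 by apply/funext => t; rewrite (ge0_funenegE g0) // inE.
rewrite /integral -/g gE gN.
(* The negative part vanishes: the only nonnegative simple function below 0 is 0. *)
set neg := ereal_sup [set sintegral J h | h in [set h : {nnsfun T >-> R} |
  forall x, (h x)%:E <= cst 0 x]].
have {neg}-> : neg = 0.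
  rewrite /neg (_ : [set _ | _ in _] = [set 0]) ?ereal_sup1 //.
  have int0 (h : T -> R) : (forall x, h x = 0%R) -> sintegral J h = 0.
    move=> h0; apply: fsbig1 => r _; have [->|r0] := eqVneq r 0%R; first by rewrite mul0e.
    rewrite (_ : _ @^-1` _ = set0) ?J0 ?mule0 //.
    by apply/seteqP; split => // t /=; rewrite h0 => /eqP; rewrite eq_sym (negbTE r0).
  apply/seteqP; split => [_ [h /= h0 <-]|_ ->] /=.
    apply: int0 => t; apply/eqP; rewrite eq_le fun_ge0 andbT.
    by have := h0 t; rewrite lee_fin.
  by exists (cst_nnsfun T (0%:nng)%R); [|exact: int0].
rewrite sube0; apply: ereal_sup_ubound.
exists (scale_nnsfun (indic_nnsfun R mD) (ltW c0)).
  move=> t /=; rewrite /g patchE /mindic indicE.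
  case: (boolP (t \in D)) => [/set_mem Dt|_]; last by rewrite mulr0.
  by rewrite mulr1 lee_fin cf.
set h := (X in sintegral _ X); have hE t : h t = (c * \1_D t)%R by [].
rewrite /sintegral -(fsbig_widen [set c] setT) //.
  rewrite fsbig_set1; congr (_ * J _); apply/seteqP; split => t /=; rewrite hE indicE.
    case: (boolP (t \in D)) => [/set_mem //|_]; rewrite mulr0 => /esym/eqP.
    by rewrite gt_eqF.
  by move=> Dt; rewrite mem_set // mulr1.
move=> r [_ /= rc]; have [->|r0] := eqVneq r 0%R; first by rewrite mul0e.
rewrite (_ : _ @^-1` _ = set0) ?J0 ?mule0 //; apply/seteqP; split => // t /=.
rewrite hE indicE; case: (_ \in _); rewrite ?mulr1 ?mulr0 => /esym // /eqP.
by rewrite (negbTE r0).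
Qed.

(** The formula for [J] is assumed on all sets, so that [J] equals a finite sum of scaled Dirac
    measures as a function and can be replaced by it in the integral. *)
Lemma integral_sum_dirac (J : set T -> \bar R) (I : finType) (z : I -> T)
    (c : I -> R) (D : set T) (f : T -> R) :
  (forall A, J A = \sum_(a | `[< A (z a) >]) (c a)%:E) ->
  (forall a, 0 <= c a)%R -> I -> measurable D -> (forall t, D t -> 0 <= f t)%R ->
  measurable_fun D f ->
  \int[J]_(t in D) (f t)%:E = \sum_(a | `[< D (z a) >]) (c a * f (z a))%:E.
Proof.
move=> JE c0 a0 mD f0 mf; pose e k := nth a0 (index_enum I) k.
pose m_ k : {measure set T -> \bar R} := mscale (NngNum (c0 (e k))) \d_(z (e k)).
have sumE (F : I -> \bar R) : \sum_(k < size (index_enum I)) F (e k) = \sum_a F a.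
  by rewrite [RHS](big_nth a0) big_mkord.
have diracE (a : I) (A : set T) : \d_(z a) A = (if `[< A (z a) >] then 1 else 0) :> \bar R.
  by rewrite /dirac indicE; case: asboolP => Az; [rewrite mem_set|rewrite memNset].
have -> : J = msum m_ (size (index_enum I)).
  apply/funext => A; rewrite JE big_mkcond /= /msum -sumE; apply: eq_bigr => k _.
  change (m_ k A) with ((c (e k))%:E * \d_(z (e k)) A).
  by rewrite diracE; case: ifP; rewrite ?mule1 ?mule0.
have mEf : measurable_fun D (fun t => (f t)%:E) by apply/measurable_EFinP.
rewrite ge0_integral_measure_sum // [RHS]big_mkcond /= -sumE.
apply: eq_bigr => k _; rewrite ge0_integral_mscale // integral_dirac // diracE /=.
by case: ifP; rewrite ?mul1e ?mul0e ?mule0 // EFinM.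
Qed.

End Integrals.

(** * Discrete measures on the sphere *)

Section BorelSphere.
Context {R : realType} {n : nat}.
Implicit Types (u v : sphere R n).

Lemma val_sphere_continuous : continuous (\val : sphere R n -> 'rV[R]_n.+1).
Proof. exact: initial_continuous. Qed.

Lemma open_borel_sphere (A : set (borel_sphere R n)) :
  open (A : set (sphere R n)) -> measurable A.
Proof. exact: sub_sigma_algebra. Qed.

Lemma closed_borel_sphere (A : set (borel_sphere R n)) :
  closed (A : set (sphere R n)) -> measurable A.
Proof.
move=> cA; rewrite -(setCK A); apply: measurableC; apply: open_borel_sphere.
exact: closed_openC.
Qed.

Lemma closed_val_preimage (C : set 'rV[R]_n.+1) :
  closed C -> closed (\val @^-1` C : set (sphere R n)).
Proof. by move=> cC; apply: preimage_closed => // v _; exact: val_sphere_continuous. Qed.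

Lemma finite_closed_sphere (A : set (sphere R n)) : finite_set A -> closed A.
Proof.
move=> fA; rewrite (_ : A = \val @^-1` (\val @` A)).
  apply: closed_val_preimage.
  have /accessible_finite_set_closed := hausdorff_accessible (@norm_hausdorff R 'rV[R]_n.+1).
  by apply; exact: finite_image.
by apply/seteqP; split => [v Av|v [u Au /sphere_val_inj <-]] //; exists v.
Qed.

Lemma finite_borel_sphere (A : set (borel_sphere R n)) :
  finite_set A -> measurable A.
Proof. by move=> fA; apply: closed_borel_sphere; exact: finite_closed_sphere. Qed.

Lemma great_subsphere_closed u : closed (great_subsphere u).
Proof.
have -> : great_subsphere u = \val @^-1` [set x | dot x (\val u) = 0] by [].
apply: closed_val_preimage.
apply: (@preimage_closed _ _ (fun x => dot x (\val u)) [set r : R | r = 0]).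
  by move=> x _; exact: continuous_dotl.
exact: closed_eq.
Qed.

Definition antipode u : sphere R n := to_sphere (etrans (enormN (\val u)) (enorm_sphere u)).

Lemma antipodeK : involutive antipode.
Proof. by move=> u; apply: sphere_val_inj; rewrite /= opprK. Qed.

Lemma antipode_neq u : antipode u != u.
Proof.
apply/eqP => /(congr1 (fun v : sphere R n => \val v)) /= h.
have := congr1 (fun y => dot y (\val u)) h; rewrite dotNl dot_sphere; lra.
Qed.

Lemma antipodal_set1 u : antipodal [set u] = [set antipode u].
Proof.
apply/seteqP; split => [v [_ -> vu]|_ ->]; last by exists u.
by apply: sphere_val_inj.
Qed.

Section RadialMeasurable.
Variable K : set 'rV[R]_n.+1.
Hypothesis bodyK : convex_body_o K.

(** By convexity [K] contains the segment from 0 to the radial point. Superlevel sets of the radial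
    function are thus preimages of closed sets, hence Borel. *)
Lemma radial_funP_ge u (c : R) : 0 < c -> (c <= radial_fun K u) <-> K (c *: \val u).
Proof.
move=> c0; have [rho0 Krho rho_ge] := radial_funP bodyK u; split=> [crho|]; last exact: rho_ge.
have [[_ Kconv _] /interior_subset K0] := bodyK.
have l0 : 0 <= c / radial_fun K u by rewrite divr_ge0 ?(ltW c0) ?(ltW rho0).
have l1 : c / radial_fun K u <= 1 by rewrite ler_pdivrMr // mul1r.
have := Kconv _ _ (Itv01 l0 l1) (mem_set Krho) (mem_set K0) => /set_mem.
by rewrite /conv /= scaler0 addr0 scalerA mulfVK // gt_eqF.
Qed.

Lemma measurable_radial_fun (w : set (borel_sphere R n)) :
  measurable w -> measurable_fun w (radial_fun K : borel_sphere R n -> R).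
Proof.
move=> mw; apply: (measurability (@RGenCInfty.G R)) => [|/= _ [_] [c] -> <-].
  exact: RGenCInfty.measurableE.
apply: measurableI => //; have [c0|c0] := leP c 0.
  rewrite (_ : _ @^-1` _ = setT) //; apply/seteqP; split => // u _ /=.
  rewrite in_itv /= andbT (le_trans c0) // ltW //.
  by have [] := radial_funP bodyK u.
rewrite (_ : _ @^-1` _ = \val @^-1` [set x | K (c *: x)]).
  apply: closed_borel_sphere; apply: closed_val_preimage.
  have -> : [set x | K (c *: x)] = (fun x => c *: x) @^-1` K by [].
  apply: preimage_closed; last exact: body_closed.
  move=> x _; apply: (@lipschitz_continuous R 'rV[R]_n.+1 _ _ `|c|) => y z.
  by rewrite -scalerBr normrZ.
apply/seteqP; split => u /=; rewrite in_itv /= andbT.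
  by move=> h; apply/(radial_funP_ge u c0).
by move=> h; apply/(radial_funP_ge u c0).
Qed.

End RadialMeasurable.

Section Support.
Local Open Scope ereal_scope.
Variable mu : {finite_measure set (borel_sphere R n) -> \bar R}.

(* Rational boxes form a countable base, so the complement of the support is
   covered by countably many null sets. *)
Lemma support_negligible : mu.-negligible (~` measure_support mu).
Proof.
pose box (ck : 'rV[rat]_n.+1 * nat) : set (sphere R n) :=
  [set v : sphere R n | forall i, (`|\val v 0 i - ratr (ck.1 0 i)| < ck.2.+1%:R^-1)%R].
have box_open ck : open (box ck).
  rewrite -closedC (_ : ~` _ = \bigcup_(i in [set: 'I_n.+1])
      (\val @^-1` [set x : 'rV[R]_n.+1 | (ck.2.+1%:R^-1 <= `|x 0 i - ratr (ck.1 0 i)|)%R])).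
    apply: closed_bigcup => [|i _]; first exact: finite_finset.
    apply: closed_val_preimage.
    apply: (@preimage_closed _ _ (fun x : 'rV[R]_n.+1 => `|x 0 i - ratr (ck.1 0 i)|%R)
      [set r : R | (ck.2.+1%:R^-1 <= r)%R]); last exact: closed_ge.
    move=> x _; apply: (@lipschitz_continuous _ _ R^o _ 1) => y z.
    rewrite mul1r; apply: le_trans (ler_dist_dist _ _) _.
    rewrite opprB addrA subrK; have := coord_le_norm (y - z) i; by rewrite !mxE.
  apply/seteqP; split => v /=.
    by move=> /existsNP[i /negP]; rewrite -leNgt => h; exists i.
  by move=> [i _ /= h] /(_ i); rewrite ltNge h.
(* Only the null boxes are kept in the enumeration. *)
pose F k := if @unpickle ('rV[rat]_n.+1 * nat)%type k is Some ck
  then (if mu (box ck) == 0 then box ck else set0) else set0.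
apply: (@negligibleS _ _ _ mu (\bigcup_k F k)); last first.
  apply: negligible_bigcup => k; rewrite /F; case: unpickle => [ck|]; last exact: negligible_set0.
  case: ifP => [/eqP b0|_]; last exact: negligible_set0.
  by apply/negligibleP => //; exact: open_borel_sphere.
move=> u /= /existsNP[A /not_implyP[oA /not_implyP[Au /negP]]].
rewrite -leNgt => muA.
have {}muA : mu A = 0 by apply/eqP; rewrite -measure_le0.
have [V oV VA] : exists2 V, open V & (\val : sphere R n -> _) @^-1` V = A by exact: oA.
have Vu : V (\val u) by rewrite -VA in Au.
have /(@nbhs_normP R 'rV[R]_n.+1)[e /= e0 eV] : nbhs (\val u) V by apply: open_nbhs_nbhs.
have e2 : (0 < e / 2)%R by rewrite divr_gt0.
have [k _ /(_ k (leqnn k)) /= ke] := near_infty_natSinv_lt (PosNum e2).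
have /choice[q qP] : forall i, exists q : rat, (`|\val u 0%R i - ratr q| < k.+1%:R^-1)%R.
  move=> i; have k0 : (0 < k.+1%:R^-1 :> R)%R by rewrite invr_gt0.
  have [|q] := @rat_in_itvoo R (\val u 0%R i - k.+1%:R^-1)%R (\val u 0%R i + k.+1%:R^-1)%R.
    by rewrite ltrBlDr -addrA ltrDl addr_gt0.
  rewrite in_itv /= => /andP[h1 h2]; exists q.
  by rewrite ltr_norml ltrBrDl !ltrBlDr h2 -ltrBlDl h1.
pose ck := (\row_i q i, k).
have boxu : box ck u by move=> i; rewrite /= mxE.
have boxA : box ck `<=` A.
  move=> v vb; rewrite -VA /=; apply: eV => /=.
  rewrite [ltLHS]/Num.norm /= mx_normrE; apply/bigmax_ltP; split => // -[i j] _ /=.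
  rewrite ord1 !mxE; have := vb j; rewrite /= mxE => h1; have h2 := qP j.
  rewrite (_ : _ - _ = (\val u 0%R j - ratr (q j)) - (\val v 0%R j - ratr (q j)))%R; last by ring.
  apply: le_lt_trans (ler_normB _ _) _.
  by rewrite [e]splitr ltrD // (lt_trans _ ke).
have box0 : mu (box ck) = 0.
  apply/eqP; rewrite -measure_le0 -muA; apply: le_measure; rewrite ?inE //.
    exact: open_borel_sphere.
  exact: open_borel_sphere.
exists (pickle ck) => //; rewrite /F pickleK box0 eqxx //.
Qed.

Lemma support_null : finite_set (measure_support mu) -> mu (~` measure_support mu) = 0.
Proof.
move=> fS; apply/negligibleP; last exact: support_negligible.
by apply: measurableC; exact: finite_borel_sphere.
Qed.

(** Removing the other support points leaves an open neighbourhood of [u], which has positive mass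
    and differs from the singleton by a null set. *)
Lemma support_point_gt0 (u : sphere R n) : finite_set (measure_support mu) ->
  measure_support mu u -> 0 < mu [set u].
Proof.
move=> fS Su; set F := measure_support mu `\` [set u].
have fF : finite_set F by exact: finite_setD.
have oF : open (~` F) by apply: closed_openC; exact: finite_closed_sphere.
apply: lt_le_trans (Su _ oF _) _; first by move=> [_]; exact.
have -> : ~` F = [set u] `|` ~` measure_support mu.
  by rewrite /F setCD setUC.
apply: le_trans (measureU2 _ _ _) _.
- exact: finite_borel_sphere.
- by apply: measurableC; exact: finite_borel_sphere.
- rewrite -[leRHS]adde0 leeD2l // le_eqVlt; apply/orP; left; apply/eqP.
  exact: support_null.
Qed.

End Support.

End BorelSphere.

(** Chooses one point from each pair {x, f x} that meets [s], adding a point only if neither it nor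
    its partner is already there. *)
Lemma half_seq (T : eqType) (f : T -> T) (s : seq T) :
  involutive f -> (forall x, f x != x) ->
  exists r : seq T, [/\ uniq r, {subset r <= s},
    forall x, x \in s -> (x \in r) || (f x \in r) &
    forall x y, x \in r -> y \in r -> x != f y].
Proof.
move=> fK fx; elim: s => [|x s [r [ur rs sr rr]]]; first by exists [::]; split.
have rs' : {subset r <= x :: s} by move=> y /rs ys; rewrite inE ys orbT.
have [xr|] := boolP ((x \in r) || (f x \in r)).
  by exists r; split => // y; rewrite inE => /predU1P[->|/sr].
rewrite negb_or => /andP[xr fxr]; exists (x :: r); split.
- by rewrite /= xr.
- by move=> y; rewrite inE => /predU1P[->|/rs' //]; rewrite inE eqxx.
- move=> y; rewrite !inE => /predU1P[->|/sr]; first by rewrite eqxx.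
  by case/orP => ->; rewrite ?orbT.
- move=> y z; rewrite !inE => /predU1P[->|yr] /predU1P[->|zr].
  + by rewrite eq_sym fx.
  + by apply: contra fxr => /eqP ->; rewrite fK.
  + by apply: contra fxr => /eqP <-.
  + exact: rr.
Qed.

Lemma measure_bigsetU_seq (d : measure_display) (T : measurableType d)
    (R : realType) (mu : {measure set T -> \bar R}) (I : choiceType) (s : seq I)
    (F : I -> set T) :
  uniq s -> (forall a, measurable (F a)) ->
  (forall a b, a != b -> F a `&` F b = set0) ->
  (mu (\big[setU/set0]_(a <- s) F a) = \sum_(a <- s) mu (F a))%E.
Proof.
move=> + mF dF; elim: s => [|a s IH] /=; first by rewrite !big_nil measure0.
move=> /andP[as_ us]; rewrite !big_cons.
have mB : measurable (\big[setU/set0]_(j <- s) F j) by exact: bigsetU_measurable.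
rewrite -IH //; apply: measureU => //.
rewrite -bigcup_seq; apply/seteqP; split => // t [Fa [b /= bs Fb]].
have ab : a != b by apply: contra as_ => /eqP ->.
have : (F a `&` F b) t by [].
by rewrite (dF _ _ ab).
Qed.

(** * Finitely supported measures and the two implications *)

Section DiscreteMeasure.
Context {R : realType} {n : nat}.
Variable mu : {finite_measure set (borel_sphere R n) -> \bar R}.

Lemma measure_finite_range (I : finType) (z : I -> borel_sphere R n)
    (w : set (borel_sphere R n)) :
  injective z -> mu (~` range z) = 0%E -> measurable w ->
  (mu w = \sum_(a | `[< w (z a) >]) mu [set z a])%E.
Proof.
move=> zinj z0 mw.
have mz a : measurable [set z a] by exact: finite_borel_sphere.
rewrite -[RHS]big_filter -measure_bigsetU_seq //; last 2 first.
- by rewrite filter_uniq // index_enum_uniq.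
- move=> a b ab; apply/seteqP; split => // v [/= -> /zinj ba].
  by rewrite ba eqxx in ab.
set C := \big[setU/set0]_(a <- _) _.
have CE : C = w `&` range z.
  rewrite /C -bigcup_seq; apply/seteqP; split => [v [a /=]|v [wv [a _ av]]].
    by rewrite mem_filter => /andP[/asboolP wa _] ->; split => //; exists a.
  exists a; last by rewrite /= av.
  by rewrite /= mem_filter mem_index_enum andbT; apply/asboolP; rewrite av.
have mr : measurable (range z) by apply: finite_borel_sphere; exact: finite_image.
have mwr : measurable (w `\` range z) by exact: measurableD.
have wz0 : (mu (w `\` range z) = 0)%E.
  apply/eqP; rewrite -measure_le0 -z0; apply: le_measure; rewrite ?inE //.
  exact: measurableC.
have mwz : measurable (w `&` range z) by exact: measurableI.
have disj : (w `&` range z) `&` (w `\` range z) = set0.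
  by rewrite setDE setIACA setICr setI0.
have wE : w = (w `&` range z) `|` (w `\` range z) by rewrite setUIDK.
rewrite {1}wE CE; apply: etrans (measureU mu mwz mwr disj) _.
by rewrite -[RHS]adde0; congr (_ + _)%E; exact: wz0.
Qed.

Lemma support_antipode (u : sphere R n) : even_measure mu ->
  finite_set (measure_support mu) -> measure_support mu u ->
  measure_support mu (antipode u).
Proof.
move=> mu_even fS Su O oO Ou.
apply: (@lt_le_trans _ _ (mu [set antipode u])).
  rewrite -antipodal_set1 -mu_even; last by exact: finite_borel_sphere.
  exact: support_point_gt0.
apply: le_measure; rewrite ?inE.
- exact: finite_borel_sphere.
- exact: open_borel_sphere.
- by move=> _ ->.
Qed.

End DiscreteMeasure.

(** As [p < 0], the bound [M] on the radial function makes the density at least [c], the p-th power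
    of [M]; it remains to find a ball of normals in the Gauss image. *)
Lemma curvature_not_concentrated (R : realType) (n : nat) (p : R)
    (K : set 'rV[R]_n.+1) (u : sphere R n) :
  p < 0 -> convex_body_o K ->
  (0 < Lp_integral_curvature p K (~` great_subsphere u))%E.
Proof.
move=> p0 bodyK; set w := ~` great_subsphere u.
have mw : measurable (w : set (borel_sphere R n)).
  by apply: measurableC; apply: closed_borel_sphere; exact: great_subsphere_closed.
have [M M0 KM] := body_bounded bodyK; have [r r0 rK] := body_ball bodyK.
pose c := expR (p * ln M); have c0 : 0 < c by exact: expR_gt0.
have cf v : w v -> c <= radial_fun K v `^ p.
  move=> _; have [rho0 Krho _] := radial_funP bodyK v.
  rewrite /powR gt_eqF // ler_expR ler_nM2l // ler_ln ?posrE //.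
  by have := KM _ Krho; rewrite enormZ enorm_sphere mulr1 ger0_norm // ltW.
apply: lt_le_trans (@integral_ge_cst _ _ _ (integral_curvature K) w _ c _ mw c0 cf); last first.
  rewrite /integral_curvature (_ : _ @` _ = set0) ?hausdorff_set0 //.
  by apply/seteqP; split => // _ [v [a []]].
rewrite mule_gt0 ?lte_fin //.
(* For [v] this close to [u], a contact point [x] orthogonal to [u] would give r / 2 <= x . v = x .
   (v - u) <= r / 4. *)
have e0 : 0 < r / 2 / (2 * M) by rewrite !divr_gt0 // mulr_gt0.
apply: lt_le_trans (hausdorff_sphere_ball_gt0 (enorm_sphere u) e0) _.
apply: le_hausdorff => v' [vS vu]; pose v := to_sphere vS.
exists v => //; have [x [Kx xv xmax]] := support_funP bodyK v.
have [u' u'x] := contact_radial bodyK Kx xv; exists u'; last first.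
  by rewrite -xv -u'x dotZl mulrC (dotC (\val v)).
rewrite /w /great_subsphere /= => u'u.
have xu : dot x (\val u) = 0 by rewrite -u'x dotZl u'u mulr0.
have hv : r / 2 <= dot x (\val v).
  rewrite xv; have <- : dot (r / 2 *: \val v) (\val v) = r / 2 by rewrite dotZl dot_sphere mulr1.
  apply: support_fun_ge => //; apply: rK.
  by rewrite enormZ enorm_sphere mulr1 gtr0_norm ?divr_gt0 // gtr_pMr // invf_lt1 // ltr1n.
have : dot x (\val v - \val u) <= M * (r / 2 / (2 * M)).
  apply: le_trans (dot_le_enorm _ _) _; apply: ler_pM; rewrite ?enorm_ge0 ?KM //.
  exact: ltW.
rewrite dotBr xu subr0 => /(le_trans hv).
have -> : M * (r / 2 / (2 * M)) = r / 4 by field; rewrite gt_eqF.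
by lra.
Qed.

Theorem theorem1p3 (R : realType) (n : nat) (p : R)
    (mu : {finite_measure set (borel_sphere R n) -> \bar R})
    (hp : -1 < p < 0)
    (mu_neq0 : nonzero_measure mu)
    (mu_even : even_measure mu)
    (mu_discrete : discrete_measure mu) :
  (exists K : set 'rV[R]_n.+1,
    [/\ convex_body_e K, polytope K
      & forall w : set (borel_sphere R n), measurable w ->
          mu w = Lp_integral_curvature p K w])
  <-> ~ (exists u : sphere R n, concentrated_on mu (great_subsphere u)).
Proof.
have /andP[p1 p0] := hp.
split=> [[K [[bodyK _] _ muK]] [u mu_u]|not_conc].
  have mw : measurable (~` great_subsphere u : set (borel_sphere R n)).
    by apply: measurableC; apply: closed_borel_sphere; exact: great_subsphere_closed.
  have := curvature_not_concentrated u p0 bodyK.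
  by rewrite -muK // mu_u ltxx.
have fS : finite_set (measure_support mu) := mu_discrete.
have [s sE] := (finite_seqP _).1 fS.
have sP u : measure_support mu u <-> u \in s by rewrite sE.
(* One representative of each antipodal pair of atoms. *)
have [r [ur rs sr rr]] := half_seq s antipodeK antipode_neq.
pose N := size r; pose U (i : 'I_N) : sphere R n := tnth (in_tuple r) i.
have Ur i : U i \in r by exact: mem_tnth.
have U_supp i : measure_support mu (U i) by apply/sP/rs.
have U_inj : injective U by apply/tuple_uniqP.
have dirf i : direction U (i, false) = U i.
  by apply: sphere_val_inj; rewrite /= expr0 scale1r.
have dirt i : direction U (i, true) = antipode (U i).
  by apply: sphere_val_inj; rewrite /= expr1 scaleN1r.
have dir_range : range (direction U) = measure_support mu.
  apply/seteqP; split => [_ [[i [] _ <-]]|u Su].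
  - by rewrite dirt; exact: support_antipode.
  - by rewrite dirf.
  - have mem_r y : y \in r -> exists i, y = U i by move=> /(tnthP (in_tuple r)).
    have /sP/sr/orP[/mem_r[i ui]|/mem_r[i ui]] := Su.
      by exists (i, false) => //; rewrite dirf.
    by exists (i, true) => //; rewrite dirt -ui antipodeK.
have supp0 := support_null fS.
have mS : measurable (~` measure_support mu : set (borel_sphere R n)).
  by apply: measurableC; exact: finite_borel_sphere.
(* A nonzero [v] orthogonal to all atoms would define a great subsphere carrying the measure. *)
have U_span (v : 'rV[R]_n.+1) : (forall i, dot v (\val (U i)) = 0) -> v = 0.
  move=> vU; apply: contrapT => /eqP v0; apply: not_conc.
  have nv0 : 0 < enorm v by rewrite enorm_gt0.
  have z1 : enorm ((enorm v)^-1 *: v) = 1.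
    by rewrite enormZ ger0_norm ?invr_ge0 ?enorm_ge0 // mulVf // gt_eqF.
  exists (to_sphere z1).
  apply/eqP; rewrite -measure_le0 -supp0; apply: le_measure; rewrite ?inE //.
    by apply: measurableC; apply: closed_borel_sphere; exact: great_subsphere_closed.
  apply: subsetC => u; rewrite -dir_range => -[[i b] _ <-].
  by rewrite /great_subsphere /= dotZl dotZr dotC vU !mulr0.
have U_indep i j : i != j -> \val (U i) != \val (U j) /\ \val (U i) != - \val (U j).
  move=> ij; split; apply: contra ij => /eqP h.
    by apply/eqP/U_inj/sphere_val_inj.
  have := rr _ _ (Ur i) (Ur j); rewrite (_ : U i = antipode (U j)) ?eqxx //.
  exact: sphere_val_inj.
have N_gt0 : (0 < N)%N.
  rewrite lt0n; apply/eqP => N0.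
  have S0 : measure_support mu = set0.
    rewrite -dir_range; apply/seteqP; split => // u [[i b] _ _].
    by have := leq_ltn_trans (leq0n i) (ltn_ord i); rewrite -/N lt0n N0.
  have [w mw] := mu_neq0; rewrite -measure_le0 -supp0 S0 setC0.
  by rewrite le_measure // inE.
pose m i := fine (mu [set U i]).
have mE i : (m i)%:E = mu [set U i].
  by rewrite fineK // fin_num_measure //; exact: finite_borel_sphere.
have m0 i : 0 < m i by rewrite -lte_fin mE; exact: support_point_gt0.
have q01 : 0 < - p < 1 by rewrite oppr_gt0 p0 ltrNl p1.
have [x xE] := exists_vertex_weights (fun i => enorm_sphere (U i)) U_span U_indep m0 q01.
pose cone := normal_cone (vertex (fun i => \val (U i)) x).
have coneE a : sphere_measure (cone a) = (m a.1 * expR (- p * x 0 a.1))%:E.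
  by case: a => i b; rewrite -(xE i b) massE.
have cone_gt0 a : (0 < sphere_measure (cone a))%E.
  by rewrite coneE lte_fin mulr_gt0 // expR_gt0.
pose K := cross_hull (fun i => expR (x 0 i) *: \val (U i)).
have K_span := p_span U_span (x := x).
have bodyK : convex_body_e K by exact: cross_hull_body.
exists K; split => //; first exact: cross_hull_polytope.
move=> w mw.
have dir_inj : injective (direction U).
  (* At [x = 0] the vertices are the directions themselves. *)
  move=> a b ab; apply: (vertex_inj (fun i => enorm_sphere (U i)) U_indep (x := 0)).
  by rewrite !vertexE ab !mxE.
have cE A : integral_curvature K A =
    (\sum_(a | `[< A (direction U a) >]) (m a.1 * expR (- p * x 0 a.1))%:E)%E.
  rewrite (integral_curvature_cross N_gt0 U_span U_indep cone_gt0).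
  by apply: eq_bigr => a _; rewrite coneE.
have c0 (a : 'I_N * bool) : 0 <= m a.1 * expR (- p * x 0 a.1) by rewrite mulr_ge0 ?expR_ge0 ?ltW.
have mf : measurable_fun w (fun u : borel_sphere R n => radial_fun K u `^ p).
  exact: measurableT_comp (measurable_powR p) (measurable_radial_fun bodyK.1 mw).
have f0 u : w u -> 0 <= radial_fun K u `^ p by move=> _; exact: powR_ge0.
rewrite /Lp_integral_curvature.
rewrite (integral_sum_dirac cE c0 (Ordinal N_gt0, true) mw f0 mf).
have z0 : mu (~` range (direction U)) = 0%E by rewrite dir_range supp0.
rewrite (measure_finite_range dir_inj z0 mw).
apply: eq_bigr => a _.
have -> : mu [set direction U a] = (m a.1)%:E.
  case: a => i [] /=; last by rewrite dirf mE.
  rewrite dirt -antipodal_set1 -mu_even ?mE //.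
  exact: finite_borel_sphere.
congr (_%:E); rewrite (radial_direction N_gt0 U_span cone_gt0).
(* The density exp (p x_i) cancels the factor exp (- p x_i) in the measure of the cone. *)
rewrite -expRM -mulrA -expRD (_ : _ + _ = 0) ?expR0 ?mulr1 //.
by ring.
Qed.
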